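(* Let $n$ be an odd prime. Then there exists a cellular biembedding of $K_{(n+1)\times 2n}$ into an orientable surface such that every face has length $4n$ or a multiple of $n^2$.
   Context: $K_{q\times r}$ denotes the complete multipartite graph with $q$ parts each of size $r$. An embedding of a graph $\Gamma$ (as a $1$-dimensional simplicial complex) in a surface $\Sigma$ is a continuous injective map $\phi:\Gamma\to\Sigma$; the connected components of $\Sigma\setminus\phi(\Gamma)$ are its faces; the embedding is cellular if every face is homeomorphic to an open disc. A circuit decomposition of a graph is a set of circuits (closed trails, without repeated edges but possibly with repeated vertices) whose edge-sets partition the edge-set. A biembedding of two circuit decompositions $\mathcal{D},\mathcal{D}'$ of a simple graph $\Gamma$ is a face $2$-colorable embedding of $\Gamma$ in which (the boundaries of the faces of) one color class are the circuits of $\mathcal{D}$ and those of the other color class are the circuits of $\mathcal{D}'$. A biembedding of $\Gamma$ means a biembedding of some two circuit decompositions of $\Gamma$. The length of a face is the number of edges of its boundary circuit. *)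

(* Defs.v *)
From HB Require Import structures.
From mathcomp Require Import all_boot all_order all_algebra.
From mathcomp Require Import all_classical all_reals all_analysis.

Set Implicit Arguments.
Unset Strict Implicit.
Unset Printing Implicit Defensive.

Import Order.TTheory GRing.Theory Num.Theory.
Import numFieldNormedType.Exports.

Local Open Scope ring_scope.

(** * Graphs and circuit decompositions

    A simple graph on a finite type [V] is a symmetric irreflexive relation
    [e : rel V].  A closed walk is represented by the sequence
    [v_0; ...; v_(k-1)] of its vertices, the last step being
    [v_(k-1) -> v_0]. *)

Definition multipartite (q r : nat) : rel ('I_q * 'I_r) :=
  fun x y => x.1 != y.1.

Definition steps (V : finType) (c : seq V) : seq (V * V) := zip c (rot 1 c).

Definition step_edges (V : finType) (c : seq V) : seq {set V} :=
  [seq [set p.1; p.2]%SET | p <- steps c].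

Definition edge_set (V : finType) (e : rel V) : {set {set V}} :=
  [set A | [exists x, exists y, e x y && (A == [set x; y])]]%SET.

Definition circuit (V : finType) (e : rel V) (c : seq V) : bool :=
  [&& c != [::], all (fun p => e p.1 p.2) (steps c) & uniq (step_edges c)].

(** A decomposition is listed by one representative vertex sequence per
    circuit. *)
Definition circuit_decomposition (V : finType) (e : rel V) (D : seq (seq V)) :
    bool :=
  all (circuit e) D &&
  perm_eq (flatten [seq step_edges c | c <- D]) (enum (edge_set e)).

Local Open Scope classical_set_scope.

(** * Surfaces *)

Notation plane R := (R * R)%type.

Definition homeomorphism_on (S T : topologicalType) (A : set S) (B : set T)
    (f : S -> T) (g : T -> S) : Prop :=
  [/\ forall x, A x -> B (f x) /\ g (f x) = x,
      forall y, B y -> A (g y) /\ f (g y) = y,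
      {within A, continuous f} &
      {within B, continuous g}].

Definition homeomorphic (S T : topologicalType) (A : set S) (B : set T) : Prop :=
  exists (f : S -> T) (g : T -> S), homeomorphism_on A B f g.

Record chart (R : realType) (S : topologicalType) := Chart {
  chart_dom : set S;
  chart_cod : set (plane R);
  chart_map : S -> plane R;
  chart_inv : plane R -> S;
  chart_dom_open : open chart_dom;
  chart_cod_open : open chart_cod;
  chart_homeo : homeomorphism_on chart_dom chart_cod chart_map chart_inv
}.

(** Closed connected surfaces; second countability is automatic, since the
    space is compact and locally Euclidean. *)
Definition surface (R : realType) (S : topologicalType) : Prop :=
  [/\ hausdorff_space S, compact [set: S], connected [set: S] &
      forall x : S, exists c : chart R S, chart_dom c x].

(** [winds_once gamma p]: the curve [gamma], restricted to [0, 2 pi], avoids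
    [p] and has winding number [+1] around it, i.e., it has polar coordinates
    [rho, theta] centred at [p] whose angle varies continuously and increases by
    [2 pi] in total. *)
Definition winds_once (R : realType) (gamma : R -> plane R) (p : plane R) :
    Prop :=
  exists rho theta : R -> R,
    [/\ {within `[0, 2 * pi], continuous theta},
        theta (2 * pi) = theta 0 + 2 * pi &
        forall t, t \in `[0, 2 * pi] -> 0 < rho t /\
          gamma t = (p.1 + rho t * cos (theta t), p.2 + rho t * sin (theta t))].

(** For an injective continuous map [f] on an open set [W], all sufficiently
    small circles around a point have the same winding number around its image,
    namely the local degree of [f], which is [1] or [-1]. *)
Definition orientation_preserving (R : realType) (W : set (plane R))
    (f : plane R -> plane R) : Prop :=
  forall p, W p -> \forall r \near 0^'+,
    winds_once (fun t => f (p.1 + r * cos t, p.2 + r * sin t)) (f p).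

Definition orientable (R : realType) (S : topologicalType) : Prop :=
  exists atlas : set (chart R S),
    (forall x : S, exists2 c, atlas c & chart_dom c x) /\
    (forall c d, atlas c -> atlas d ->
       orientation_preserving
         (chart_map c @` (chart_dom c `&` chart_dom d))
         (chart_map d \o chart_inv c)).

Definition open_disc (R : realType) : set (plane R) :=
  [set p | p.1 ^+ 2 + p.2 ^+ 2 < 1].

Definition closed_disc (R : realType) : set (plane R) :=
  [set p | p.1 ^+ 2 + p.2 ^+ 2 <= 1].

(** * Embeddings of graphs

    A graph is realized as a simplicial complex by barycentric coordinates,
    inside [V -> R] with the product topology; [edge_point u v t] is the point
    at parameter [t] on the segment from the vertex [u] to the vertex [v]. *)

Definition edge_point (R : realType) (V : finType) (u v : V) (t : R) :
    {ptws V -> R} :=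
  fun w => (1 - t) * (w == u)%:R + t * (w == v)%:R.

(** The case [u = v] is the 0-simplex [u]. *)
Definition realization (R : realType) (V : finType) (e : rel V) :
    set {ptws V -> R} :=
  [set x | exists u v t,
    [/\ (u == v) || e u v, t \in `[0, 1] & x = edge_point u v t]].

Section Embedding.
Variables (R : realType) (V : finType) (e : rel V) (S : topologicalType).
Variable phi : {ptws V -> R} -> S.

Definition embedding : Prop :=
  {within realization e, continuous phi} /\
  (forall x y, realization e x -> realization e y -> phi x = phi y -> x = y).

Definition face (F : set S) : Prop :=
  exists2 x, (~` (phi @` realization e)) x &
    F = connected_component (~` (phi @` realization e)) x.

Definition cellular : Prop :=
  forall F, face F -> homeomorphic F (@open_disc R).

(** [F] is the homeomorphic image of the open disc under a continuous map [g]
    on the closed disc which, along the unit circle divided into [size c] equal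
    arcs, follows the successive edges of the closed walk [c]. *)
Definition bounded_by (F : set S) (c : seq V) : Prop :=
  exists (g : plane R -> S) (h : S -> plane R),
    [/\ {within @closed_disc R, continuous g},
        homeomorphism_on (@open_disc R) F g h &
        forall (x0 : V) (i : nat) (t : R), (i < size c)%N -> t \in `[0, 1] ->
          let a := 2 * pi * (i%:R + t) / (size c)%:R in
          g (cos a, sin a) =
          phi (edge_point (nth x0 c i) (nth x0 (rot 1 c) i) t)].

Definition face_length (F : set S) (k : nat) : Prop :=
  exists c, [/\ circuit e c, bounded_by F c & size c = k].

Definition incident (F : set S) (u v : V) : Prop :=
  forall t : R, t \in `[0, 1] -> closure F (phi (edge_point u v t)).

(** Only the values of [color] at faces matter. *)
Definition proper_face_coloring (color : set S -> bool) : Prop :=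
  forall F G u v, face F -> face G -> F <> G -> e u v ->
    incident F u v -> incident G u v -> color F <> color G.

Definition class_boundaries (color : set S -> bool) (b : bool)
    (D : seq (seq V)) : Prop :=
  (forall F, face F -> color F = b -> exists2 c, c \in D & bounded_by F c) /\
  (forall c, c \in D -> exists F, [/\ face F, color F = b & bounded_by F c]).

Definition biembedding_of (D D' : seq (seq V)) : Prop :=
  [/\ embedding, circuit_decomposition e D, circuit_decomposition e D' &
      exists color, [/\ proper_face_coloring color,
        class_boundaries color true D & class_boundaries color false D']].

Definition biembedding : Prop := exists D D', biembedding_of D D'.

End Embedding.

(* Main.v *)
(** All faces can be given a length divisible by [N = n ^ 2].

    Identify the vertices with Z/v, where v = 2n(n+1), two of them being
    adjacent when their difference is not a multiple of n+1.  Since v/2 is such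
    a multiple, the N remaining integers x_0, ..., x_(N-1) between 0 and v/2
    represent every admissible difference once up to sign.  Let the rotation at
    each vertex send +x_i to -x_(i+1) and -x_i to +x_(i+1); it is one cycle of
    length 2N because N is odd.  The faces of one colour successively add
    x_0, x_1, x_2, ... (cyclically), those of the other colour subtract them, so
    that each closes up after a multiple of N steps.

    A map given by such permutations of darts is realized inside a space of
    barycentric coordinates, as a simplicial complex: besides the vertices it
    has a point for each dart d = (u -> v), lying in the face to the left of d,
    and a centre o for each face, with triangles (u, v, d), (d, v, d') and
    (o, d, d'), where d' follows d on its face.  This subdivision is a genuine
    simplicial complex even if a face visits a vertex several times.  The open
    star of each of its vertices is unfolded onto a polygon by a linear map;
    the resulting charts change by piecewise linear maps of winding number 1. *)

Require Import Defs.
From HB Require Import structures.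
From mathcomp Require Import all_boot all_order all_algebra.
From mathcomp Require Import all_classical all_reals all_analysis.
From mathcomp Require Import ring lra zify.

Set Implicit Arguments.
Unset Strict Implicit.
Unset Printing Implicit Defensive.

Import Order.TTheory GRing.Theory Num.Theory.
Import numFieldNormedType.Exports.

Local Open Scope ring_scope.
Local Open Scope classical_set_scope.

(** * Topological preliminaries *)

(** The statement is about topological spaces, so the map of darts needs explicit charts and
    explicit discs, and two devices avoid gluing functions triangle by triangle. Tent functions
    invert a star chart by one formula valid on the whole plane, hence continuous at once. A face
    and the disc are both images of the same finitely many unit squares, by polar coordinates; where
    the two parametrizations identify the same points, compactness gives continuous maps in both
    directions without any formula for the inverse. Orientability is tested on genuine circles. A
    change of charts is affine on either side of one line, and in a suitable frame the image of a
    small circle never points opposite to the moving radius, so both turn once. Regular polygons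
    serve as charts only from four sides on: a dart point has five neighbours, a face centre one for
    each dart of its face, a vertex three for each outgoing dart. The sign change in the rotation is
    what makes the colours of the faces alternate around a vertex. *)

Lemma compact_within_preimage (T A : topologicalType) (K : set T) (f : T -> A)
    (C : set A) :
  compact K -> {within K, continuous f} -> closed C -> compact (K `&` f @^-1` C).
Proof.
move=> cK /continuous_closedP cf /cf /closed_subspaceP[Z cZ ZE].
by rewrite setIC -ZE setIC; exact: compact_closedI.
Qed.

(** Inside the image of [K0], the preimage by [h] of a closed set [C] is the trace of the union of
    the sets [G i (K & P i^-1 C)], which are compact, hence closed. [K0] need not be compact:
    comparing a point of [K0] with one of [K] prevents the rest of [K] from being mapped into the
    image of [K0]. This yields the maps in both directions between a disc and a face. *)
Lemma factor_through_compact (I : finType) (T A B : topologicalType) (a0 : A)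
    (K K0 : set T) (P : I -> T -> A) (G : I -> T -> B) :
  compact K -> hausdorff_space B ->
  (forall i, {within K, continuous (P i)}) ->
  (forall i, {within K, continuous (G i)}) ->
  K0 `<=` K ->
  (forall i j s t, K0 s -> K t -> G i s = G j t -> K0 t /\ P i s = P j t) ->
  exists2 h : B -> A, (forall i t, K0 t -> h (G i t) = P i t) &
    {within [set b | exists i t, K0 t /\ b = G i t], continuous h}.
Proof.
move=> cK hB cP cG K0K inj.
set U := [set b | _].
have /choice[h hP] : forall b, exists a,
    forall i t, K0 t -> b = G i t -> a = P i t.
  move=> b; have [[i [t [K0t ->]]]|nUb] := pselect (U b).
    by exists (P i t) => j s K0s e; case: (inj _ _ _ _ K0t (K0K _ K0s) e).
  by exists a0 => i t K0t bE; case: nUb; exists i, t.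
have hG i t : K0 t -> h (G i t) = P i t by move=> K0t; exact: hP.
exists h => //.
apply/continuous_closedP => C cC; apply/closed_subspaceP.
exists (\bigcup_i (G i @` (K `&` P i @^-1` C))).
  apply: closed_bigcup; first exact: finite_finset.
  move=> i _; apply: compact_closed => //; apply: continuous_compact.
    by apply: continuous_subspaceW (cG i); exact: subIsetl.
  exact: compact_within_preimage.
rewrite eqEsubset; split=> b.
  case=> -[i _ [t [Kt /= Ct] <-]] Ub; split => //.
  case: Ub => j [s [K0s e]] /=; have [K0t Pe] := inj _ _ _ _ K0s Kt (esym e).
  by rewrite /from_subspace /= hG.
case=> Cb Ub; split => //; case: Ub => i [t [K0t bE]].
exists i => //; exists t => //; split; first exact: K0K.
by move: Cb; rewrite /= /from_subspace bE hG.
Qed.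

Lemma cvg_ptws (I : Type) (T : topologicalType) (F : set_system {ptws I -> T})
    (f : {ptws I -> T}) : Filter F ->
  (forall i, g i @[g --> F] --> f i) -> F --> f.
Proof.
move=> FF cF; apply/cvg_sup => i U [_ [[W oW <-]] /= Wfi sWU].
by apply: filterS sWU _; apply: (cF i); exact: open_nbhs_nbhs.
Qed.

Lemma continuous_ptws (I : Type) (S T : topologicalType)
    (f : S -> {ptws I -> T}) :
  (forall i, continuous (fun x => f x i)) -> continuous f.
Proof. by move=> cf x; apply: cvg_ptws => i; exact: cf. Qed.

Lemma ptws_eval_continuous (I : eqType) (T : topologicalType) (i : I) :
  continuous (fun p : {ptws I -> T} => p i).
Proof. exact: (@proj_continuous I (fun=> T) i). Qed.

Section SubspaceType.
Variables (X : topologicalType) (A : set X).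

Lemma set_val_continuous : continuous (set_val : A -> X).
Proof. exact: initial_continuous. Qed.

Lemma to_set_type_continuous (Y : topologicalType) (f : Y -> A) :
  continuous (set_val \o f) -> continuous f.
Proof. exact: (@continuous_comp_initial A Y X set_val). Qed.

Lemma to_set_type_within (Y : topologicalType) (D : set Y) (f : Y -> A)
    (g : Y -> X) : (forall y, D y -> set_val (f y) = g y) ->
  {within D, continuous g} -> {within D, continuous f}.
Proof.
move=> fg cg; apply: (@to_set_type_continuous (subspace D) f).
by apply: (@subspace_eq_continuous _ D _ g) => // y /set_mem /fg.
Qed.

Lemma set_type_hausdorff : hausdorff_space X -> hausdorff_space A.
Proof.
move=> hX x y clxy; apply: val_inj; apply: hX => U V xU yV.
have [z [zU zV]] := clxy _ _ (set_val_continuous xU) (set_val_continuous yV).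
by exists (set_val z).
Qed.

Lemma set_type_compact : compact A -> compact [set: A].
Proof.
move=> cA F FF _.
have [|x [Ax clx]] := cA (set_val @ F) _.
  by apply: (@filterS _ F _ setT); [case=> y Ay _; exact: set_mem Ay | exact: filterT].
exists (exist _ x (mem_set Ax)); split => // U V FU [_ [[W oW <-]] /= Wx sWV].
have [z [[u Uu uz] Wz]] : (set_val @` U) `&` W !=set0.
  apply: clx; last exact: open_nbhs_nbhs.
  by apply: (@filterS _ F _ U) => // u Uu; exists u.
by exists u; split => //; apply: sWV; rewrite /= uz.
Qed.
End SubspaceType.

(** * Winding numbers, polar coordinates and tent functions *)

(** The tangent of half the polar angle of [(d, c)] is [c / (n + d)]. This choice of angle is
    continuous away from the negative half-axis, where [n + d] vanishes. *)
Lemma half_angle (R : realType) (n d c : R) :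
  0 < n -> 0 < n + d -> d ^+ 2 + c ^+ 2 = n ^+ 2 ->
  n * cos (2 * atan (c / (n + d))) = d /\ n * sin (2 * atan (c / (n + d))) = c.
Proof.
move=> n0 nd0 e; set u := c / (n + d); set t := atan u.
have cu : c = u * (n + d) by rewrite /u divfK // gt_eqF.
have ct0 : cos t != 0.
  by rewrite gt_eqF // cos_gt0_pihalf // atan_gtNpi2 atan_ltpi2.
have st : sin t = u * cos t.
  by rewrite -[u in u * _]atanK -/t /tan divfK.
have c2 : cos t ^+ 2 * (1 + u ^+ 2) = 1.
  by rewrite -[RHS](cos2Dsin2 t) st; ring.
have u2 : (1 + u ^+ 2) * (n + d) = 2 * n.
  have nd : n + d != 0 by rewrite gt_eqF.
  apply: (mulIf nd).
  have -> : (1 + u ^+ 2) * (n + d) * (n + d) = (n + d) ^+ 2 + (u * (n + d)) ^+ 2.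
    by ring.
  rewrite -cu; have -> : c ^+ 2 = n ^+ 2 - d ^+ 2 by rewrite -e; ring.
  by ring.
have c3 : 2 * n * cos t ^+ 2 = n + d.
  have -> : 2 * n * cos t ^+ 2 = (n + d) * (cos t ^+ 2 * (1 + u ^+ 2)).
    by rewrite -u2; ring.
  by rewrite c2 mulr1.
have -> : 2 * t = t + t by ring.
rewrite cosD sinD st; split.
  have -> : n * (cos t * cos t - u * cos t * (u * cos t)) =
    2 * n * cos t ^+ 2 - n * (cos t ^+ 2 * (1 + u ^+ 2)) by ring.
  by rewrite c3 c2; ring.
have -> : n * (u * cos t * cos t + cos t * (u * cos t)) =
  u * (2 * n * cos t ^+ 2) by ring.
by rewrite c3 cu.
Qed.

Lemma sqrtr_sqrD_gt_norm (R : realType) (a b : R) :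
  b != 0 -> `|a| < Num.sqrt (a ^+ 2 + b ^+ 2).
Proof.
move=> b0; rewrite -sqrtr_sqr ltr_sqrt; last first.
  by rewrite ltr_wpDl ?sqr_ge0// exprn_even_gt0.
by rewrite ltrDl exprn_even_gt0.
Qed.

Lemma polar (R : realType) (x y : R) : exists r t : R,
  [/\ 0 <= r, 0 <= t < 2 * pi, x = r * cos t & y = r * sin t].
Proof.
suff [r [t [r0 t0 xE yE]]] : exists r t : R,
    [/\ 0 <= r, - pi <= t <= pi, x = r * cos t & y = r * sin t].
  have p0 := @pi_gt0 R.
  have [tge|tlt] := leP 0 t.
    by exists r, t; split => //; lra.
  exists r, (t + pi *+ 2); split => //; first by rewrite mulr2n; lra.
    by rewrite cosD2pi.
  by rewrite sinD2pi.
have p0 := @pi_gt0 R.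
have [->|y0] := eqVneq y 0.
  have [xge|xlt] := leP 0 x.
    by exists x, 0; rewrite cos0 sin0 mulr1 mulr0; split => //; lra.
  by exists (- x), pi; rewrite cospi sinpi mulr0; split; lra.
set n := Num.sqrt (x ^+ 2 + y ^+ 2).
have nx : `|x| < n by exact: sqrtr_sqrD_gt_norm.
have n0 : 0 < n by apply: le_lt_trans nx.
have nx0 : 0 < n + x by move: nx; rewrite ltr_norml; lra.
have nE : x ^+ 2 + y ^+ 2 = n ^+ 2.
  by rewrite sqr_sqrtr // addr_ge0 ?sqr_ge0.
have [c s] := half_angle n0 nx0 nE.
exists n, (2 * atan (y / (n + x))); split => //; first exact: ltW.
by have := atan_gtNpi2 (y / (n + x)); have := atan_ltpi2 (y / (n + x)); lra.
Qed.

(* [(A, B)] is never a negative multiple of the vector of angle [t - psi], so it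
   turns once with that vector; the angle between the two is computed by
   [half_angle]. *)
Lemma winds_once_leash (R : realType) (c : plane R) (phi psi : R) (A B : R -> R) :
  continuous A -> continuous B -> A (2 * pi) = A 0 -> B (2 * pi) = B 0 ->
  (forall t, 0 < Num.sqrt (A t ^+ 2 + B t ^+ 2) +
             (A t * cos (t - psi) + B t * sin (t - psi))) ->
  winds_once (fun t => (c.1 + (cos phi * A t - sin phi * B t),
                        c.2 + (sin phi * A t + cos phi * B t))) c.
Proof.
move=> cA cB Ap Bp leash.
pose n t := Num.sqrt (A t ^+ 2 + B t ^+ 2).
pose d t := A t * cos (t - psi) + B t * sin (t - psi).
pose e t := B t * cos (t - psi) - A t * sin (t - psi).
have nE t : d t ^+ 2 + e t ^+ 2 = n t ^+ 2.
  rewrite sqr_sqrtr ?addr_ge0 ?sqr_ge0 // -[RHS]mulr1 -(cos2Dsin2 (t - psi)).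
  by rewrite /d /e; ring.
have n_ge0 t : 0 <= n t by exact: sqrtr_ge0.
have nd t : 0 < n t + d t by exact: leash.
have n0 t : 0 < n t.
  rewrite lt_neqAle n_ge0 andbT eq_sym; apply/eqP => n0.
  have := nd t; have := nE t; rewrite n0 add0r => h dt.
  have : 0 < d t ^+ 2 by exact: exprn_gt0.
  by have := sqr_ge0 (e t); lra.
have ccos : continuous (fun t : R => cos (t - psi)).
  move=> t; apply: continuous_comp; last exact: continuous_cos.
  by apply: cvgB; [exact: cvg_id|exact: cvg_cst].
have csin : continuous (fun t : R => sin (t - psi)).
  move=> t; apply: continuous_comp; last exact: continuous_sin.
  by apply: cvgB; [exact: cvg_id|exact: cvg_cst].
have cd : continuous d.
  by move=> t; apply: cvgD; apply: cvgM; (exact: cA || exact: cB || exact: ccos || exact: csin).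
have ce : continuous e.
  by move=> t; apply: cvgB; apply: cvgM; (exact: cA || exact: cB || exact: ccos || exact: csin).
have cn : continuous n.
  move=> t; apply: continuous_comp; last exact: sqrt_continuous.
  by apply: cvgD; apply: cvgM; (exact: cA || exact: cB).
exists n, (fun t => phi + (t - psi) + 2 * atan (e t / (n t + d t))); split.
- apply: continuous_subspaceT => t; apply: cvgD.
    apply: cvgD; first exact: cvg_cst.
    by apply: cvgB; [exact: cvg_id|exact: cvg_cst].
  apply: cvgM; first exact: cvg_cst.
  apply: continuous_comp; last exact: continuous_atan.
  apply: cvgM; first exact: ce.
  apply: cvgV; first by rewrite gt_eqF.
  by apply: cvgD; [exact: cn|exact: cd].
- have pe : e (2 * pi) = e 0.
    rewrite /e Ap Bp (_ : 2 * pi - psi = 0 - psi + pi *+ 2); last first.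
      by rewrite mulr2n; ring.
    by rewrite cosD2pi sinD2pi.
  have pd : d (2 * pi) = d 0.
    rewrite /d Ap Bp (_ : 2 * pi - psi = 0 - psi + pi *+ 2); last first.
      by rewrite mulr2n; ring.
    by rewrite cosD2pi sinD2pi.
  have pn : n (2 * pi) = n 0 by rewrite /n Ap Bp.
  by rewrite pe pd pn; ring.
move=> t _; split => //.
have [c1 s1] := half_angle (n0 t) (nd t) (nE t).
have A1 : A t = d t * cos (t - psi) - e t * sin (t - psi).
  by rewrite -[LHS]mulr1 -(cos2Dsin2 (t - psi)) /d /e; ring.
have B1 : B t = d t * sin (t - psi) + e t * cos (t - psi).
  by rewrite -[LHS]mulr1 -(cos2Dsin2 (t - psi)) /d /e; ring.
rewrite (_ : phi + (t - psi) + _ = phi + ((t - psi) + 2 * atan (e t / (n t + d t))));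
  last by ring.
set al := 2 * atan _ in c1 s1 *.
rewrite (cosD phi) (sinD phi) (cosD (t - psi)) (sinD (t - psi)).
by rewrite A1 B1 -c1 -s1; congr (_ + _, _ + _); ring.
Qed.

(** [(A, B)] is the displacement of the image of a circle under [(X, Y) |-> (X - kappa |Y|, mu Y)].
    It is never opposite to the radius [(x, y)]: if [y = 0] it equals [r] times the radius, and if
    [y != 0] and it is collinear with the radius, the second coordinates give the positive ratio
    [mu * r]. *)
Lemma winds_once_fold (R : realType) (c : plane R) (phi psi mu kappa Y r : R) :
  0 < mu -> 0 < r ->
  let h t := r * cos (t - psi) in let k t := r * sin (t - psi) in
  let A t := h t - kappa * (`|Y + k t| - `|Y|) in let B t := mu * k t in
  winds_once (fun t => (c.1 + (cos phi * A t - sin phi * B t),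
                        c.2 + (sin phi * A t + cos phi * B t))) c.
Proof.
move=> mu0 r0 h k A B.
have ch : continuous h.
  move=> t; apply: cvgM; first exact: cvg_cst.
  apply: continuous_comp; last exact: continuous_cos.
  by apply: cvgB; [exact: cvg_id|exact: cvg_cst].
have ck : continuous k.
  move=> t; apply: cvgM; first exact: cvg_cst.
  apply: continuous_comp; last exact: continuous_sin.
  by apply: cvgB; [exact: cvg_id|exact: cvg_cst].
have per : h (2 * pi) = h 0 /\ k (2 * pi) = k 0.
  rewrite /h /k (_ : 2 * pi - psi = 0 - psi + pi *+ 2); last first.
    by rewrite mulr2n; ring.
  by rewrite cosD2pi sinD2pi.
apply: (@winds_once_leash R c phi psi A B).
- move=> t; apply: cvgB; first exact: ch.
  apply: cvgM; first exact: cvg_cst.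
  apply: cvgB; last exact: cvg_cst.
  by apply: cvg_norm; apply: cvgD; [exact: cvg_cst|exact: ck].
- by move=> t; apply: cvgM; [exact: cvg_cst|exact: ck].
- by rewrite /A; case: per => -> ->.
- by rewrite /B; case: per => _ ->.
move=> t; have := cos2Dsin2 (t - psi).
rewrite /B /A /h /k; set x := cos _; set y := sin _ => xy.
set a := _ - kappa * _; set b := mu * _.
have [y0|y0] := eqVneq y 0.
  have x2 : x ^+ 2 = 1 by rewrite -xy y0; ring.
  have -> : a * x + b * y = r * x ^+ 2 by rewrite /a /b y0 !mulr0 !addr0 subrr; ring.
  by rewrite x2 mulr1 ltr_wpDl // sqrtr_ge0.
set d := a * x + b * y; set e := b * x - a * y.
have nE : a ^+ 2 + b ^+ 2 = d ^+ 2 + e ^+ 2.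
  by rewrite -[LHS]mulr1 -xy /d /e; ring.
have bE : b = d * y + e * x by rewrite -[LHS]mulr1 -xy /d /e; ring.
have [e0|e0] := eqVneq e 0.
  have dE : d = mu * r.
    by apply: (mulIf y0); move: bE; rewrite e0 mul0r addr0 => <-; rewrite /b mulrA.
  by rewrite ltr_wpDl ?sqrtr_ge0 // dE mulr_gt0.
by rewrite nE; have := sqrtr_sqrD_gt_norm d e0; rewrite ltr_norml; lra.
Qed.

(** * Sectors of the plane and tent functions *)

Lemma truncn_sector (R : realType) (k : nat) (t : R) : (0 < k)%N ->
  0 <= t < 2 * pi ->
  exists2 j, (j < k)%N &
    j%:R * (2 * pi / k%:R) <= t <= j.+1%:R * (2 * pi / k%:R).
Proof.
move=> k0 /andP[t0 t2].
have p0 := @pi_gt0 R.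
have k0' : 0 < k%:R :> R by rewrite ltr0n.
have d0 : 0 < 2 * pi / k%:R :> R by rewrite divr_gt0 // mulr_gt0.
have x0 : 0 <= t / (2 * pi / k%:R) by rewrite divr_ge0 // ltW.
have /andP[l1 l2] := truncn_itv x0.
exists (Num.truncn (t / (2 * pi / k%:R))).
  rewrite -(ltr_nat R); apply: le_lt_trans l1 _.
  by rewrite ltr_pdivrMr // mulrC divfK ?gt_eqF.
by rewrite -ler_pdivlMr // l1 -ler_pdivrMr //= ltW.
Qed.

Lemma plane_sector (R : realType) (k : nat) (x y : R) : (2 < k)%N ->
  let d := 2 * pi / k%:R in
  exists j (a b : R), [/\ (j < k)%N, 0 <= a, 0 <= b,
    x = a * cos (j%:R * d) + b * cos (j.+1%:R * d) &
    y = a * sin (j%:R * d) + b * sin (j.+1%:R * d)].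
Proof.
move=> k2 d; have [r [t [r0 t0 -> ->]]] := polar x y.
have p0 := @pi_gt0 R.
have k0' : 2 < k%:R :> R by rewrite (ltr_nat R 2).
have [j jk /andP[j1 j2]] := truncn_sector (ltnW (ltnW k2)) t0.
have d0 : 0 < d by rewrite divr_gt0 // ?mulr_gt0 //; lra.
have d1 : d < pi.
  by rewrite /d ltr_pdivrMr ?(mulrC 2) ?ltr_pM2l //; lra.
have sd : 0 < sin d by rewrite sin_gt0_pi // d0.
have jS : j.+1%:R * d = j%:R * d + d by rewrite -natr1; ring.
rewrite -/d in j1 j2.
rewrite jS in j2.
(* Cramer's rule for two unit vectors at angle [d], whose determinant is [sin d]. *)
exists j, (r * sin (j%:R * d + d - t) / sin d), (r * sin (t - j%:R * d) / sin d).
split => //.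
- by rewrite divr_ge0 ?(ltW sd) // mulr_ge0 // sin_ge0_pi //; lra.
- by rewrite divr_ge0 ?(ltW sd) // mulr_ge0 // sin_ge0_pi //; lra.
- apply: (mulIf (lt0r_neq0 sd)); rewrite jS mulrDl -!mulrA.
  rewrite ![(sin d)^-1 * _]mulrC -!mulrA !mulfV ?gt_eqF // !mulr1.
  rewrite (sinB t) (sinB (j%:R * d + d)) cosD sinD.
  have := cos2Dsin2 (j%:R * d); set C := cos (j%:R * d); set S := sin (j%:R * d).
  by move=> CS; rewrite -[LHS]mulr1 -CS; ring.
- apply: (mulIf (lt0r_neq0 sd)); rewrite jS mulrDl -!mulrA.
  rewrite ![(sin d)^-1 * _]mulrC -!mulrA !mulfV ?gt_eqF // !mulr1.
  rewrite (sinB t) (sinB (j%:R * d + d)) cosD sinD.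
  have := cos2Dsin2 (j%:R * d); set C := cos (j%:R * d); set S := sin (j%:R * d).
  by move=> CS; rewrite -[LHS]mulr1 -CS; ring.
Qed.

Definition rotx (R : realType) (psi : R) (q : plane R) : R :=
  q.1 * cos psi + q.2 * sin psi.
Definition roty (R : realType) (psi : R) (q : plane R) : R :=
  q.2 * cos psi - q.1 * sin psi.
(* With [d = 2 pi / k], these [k] functions (for [psi] a multiple of [d]) give
   the coefficients of [q] on the two unit vectors, of angles multiples of [d],
   that bound a sector containing [q]; see [tent_sector]. *)
Definition tent (R : realType) (d psi : R) (q : plane R) : R :=
  Num.max 0 (rotx psi q - cos d / sin d * `|roty psi q|).


Lemma tent_continuous (R : realType) (d psi : R) : continuous (tent d psi).
Proof.
have c1 : continuous (fun q : plane R => q.1) by move=> q; exact: cvg_fst.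
have c2 : continuous (fun q : plane R => q.2) by move=> q; exact: cvg_snd.
apply: (@max_fun_continuous _ _ R (cst 0)); first by move=> q; exact: cvg_cst.
move=> q; apply: cvgB.
  by apply: cvgD; apply: cvgM; (exact: cvg_cst || exact: c1 || exact: c2).
apply: cvgM; first exact: cvg_cst.
apply: cvg_norm; apply: cvgB; apply: cvgM;
  by [exact: cvg_cst | exact: c1 | exact: c2].
Qed.

(** [m] is [j - l] modulo [k]: the position of sector [j] as seen from axis [l]. The second
    alternative is a subtraction that wraps around once. *)
Lemma trig_subn (R : realType) (k j l m : nat) : (0 < k)%N ->
  let d : R := 2 * pi / k%:R in
  (j = l + m \/ j + k = l + m)%N ->
  cos (j%:R * d - l%:R * d) = cos (m%:R * d) /\
  sin (j%:R * d - l%:R * d) = sin (m%:R * d).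
Proof.
move=> k0 d; have kd : k%:R * d = pi *+ 2.
  by rewrite /d mulrC divfK ?pnatr_eq0 -?lt0n // mulr2n; ring.
move=> [->|e].
  by rewrite natrD (_ : (l%:R + m%:R) * d - _ = m%:R * d) //; ring.
have -> : m%:R * d = j%:R * d - l%:R * d + pi *+ 2.
  rewrite -kd; have : (j%:R + k%:R : R) = l%:R + m%:R by rewrite -!natrD e.
  by move=> h; rewrite -[j%:R](addrK k%:R) h; ring.
by rewrite cosD2pi sinD2pi.
Qed.

(** In the frame of axis [l] the point lies between the angles [m * d] and [m * d + d]. For [m = 0]
    or [m = k.-1] the axis bounds the sector and the formula returns the coefficient; otherwise the
    expression inside [tent] is nonpositive. More than three sectors give [0 <= cos d], on which
    this last case relies. *)
Lemma tent_sector (R : realType) (k j l : nat) (a b : R) :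
  (3 < k)%N -> (j < k)%N -> (l < k)%N -> 0 <= a -> 0 <= b ->
  let d := 2 * pi / k%:R in
  tent d (l%:R * d) (a * cos (j%:R * d) + b * cos (j.+1%:R * d),
                     a * sin (j%:R * d) + b * sin (j.+1%:R * d)) =
  if l == j then a else if l == (j.+1 %% k)%N then b else 0.
Proof.
move=> k3 jk lk a0 b0 d.
have p0 := @pi_gt0 R.
have k0 : (0 < k)%N by exact: leq_trans jk.
have k0' : 4 <= k%:R :> R by rewrite (ler_nat R 4).
have kp : 0 < k%:R :> R by lra.
have d0 : 0 < d by rewrite divr_gt0 // ?mulr_gt0 //; lra.
have d1 : d <= pi / 2.
  rewrite /d ler_pdivrMr // (_ : pi / 2 * _ = pi * (k%:R / 2)); last by ring.
  by rewrite (mulrC 2) ler_pM2l //; lra.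
have kd : k%:R * d = 2 * pi by rewrite /d mulrC divfK ?gt_eqF.
have sd : 0 < sin d by rewrite sin_gt0_pi // d0; lra.
have cd : 0 <= cos d by rewrite cos_ge0_pihalf //; lra.
have [m [mk jm]] : exists m, (m < k)%N /\ (j = l + m \/ j + k = l + m)%N.
  by case: (leqP l j) => lj; [exists (j - l)%N | exists (j + k - l)%N]; lia.
have [cm sm] := trig_subn R k0 jm; rewrite -/d in cm sm.
set q := (_, _).
have qx : rotx (l%:R * d) q = a * cos (m%:R * d) + b * cos (m%:R * d + d).
  rewrite (cosD (m%:R * d)) -cm -sm (cosB (j%:R * d)) (sinB (j%:R * d)) /q /rotx /=.
  rewrite (_ : j.+1%:R * d = j%:R * d + d); last by rewrite -natr1; ring.
  by rewrite cosD sinD; ring.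
have qy : roty (l%:R * d) q = a * sin (m%:R * d) + b * sin (m%:R * d + d).
  rewrite (sinD (m%:R * d)) -cm -sm (cosB (j%:R * d)) (sinB (j%:R * d)) /q /roty /=.
  rewrite (_ : j.+1%:R * d = j%:R * d + d); last by rewrite -natr1; ring.
  by rewrite cosD sinD; ring.
rewrite /tent qx qy.
have [lj|lj] := eqVneq l j.
  have -> : m = 0%N by lia.
  rewrite mul0r add0r cos0 sin0 mulr1 mulr0 add0r normrM (gtr0_norm sd).
  rewrite (ger0_norm b0) (_ : _ - _ = a); last by field; rewrite gt_eqF.
  exact: max_r.
have [lj1|lj1] := eqVneq l (j.+1 %% k)%N.
  have [c1 s1] : cos (m%:R * d) = cos d /\ sin (m%:R * d) = - sin d.
    have mE : m = k.-1.
      move: lj1; case: (ltnP j.+1 k) => h; first by rewrite modn_small //; lia.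
      have -> : j.+1 = k by lia.
      by rewrite modnn; lia.
    rewrite mE (_ : k.-1%:R * d = - d + pi *+ 2).
      by rewrite cosD2pi sinD2pi cosN sinN.
    by rewrite -subn1 natrB // mulrBl kd mulr2n; ring.
  rewrite cosD sinD c1 s1 (_ : a * - sin d + b * _ = - (a * sin d)); last by ring.
  rewrite normrN normrM (gtr0_norm sd) (ger0_norm a0).
  rewrite (_ : a * _ + b * _ - _ = b * (cos d ^+ 2 + sin d ^+ 2)); last first.
    by field; rewrite gt_eqF.
  by rewrite cos2Dsin2 mulr1; exact: max_r.
have [m0 mk2] : (0 < m /\ m.+2 <= k)%N.
  case: (ltnP j.+1 k) lj1 => h; first by rewrite modn_small // => /eqP; lia.
  have -> : j.+1 = k by lia.
  by rewrite modnn => /eqP; lia.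
apply: max_l; rewrite -(pmulr_rle0 _ sd).
set Y := a * sin _ + _.
rewrite (_ : sin d * _ = sin d * (a * cos (m%:R * d) + b * cos (m%:R * d + d)) -
  cos d * `|Y|); last by field; rewrite gt_eqF.
have m1 : (m%:R - 1) = (m.-1)%:R :> R by rewrite -subn1 natrB.
have m2 : (m%:R + 2) <= k%:R :> R by rewrite -natrD ler_nat; lia.
have md : m%:R * d + d + d <= 2 * pi.
  by rewrite -kd (_ : _ + d + d = (m%:R + 2) * d); [rewrite ler_pM2r|ring].
have m3 : 0 <= m%:R * d - d.
  by rewrite (_ : _ - d = m.-1%:R * d); [rewrite mulr_ge0 // ltW|rewrite -m1; ring].
(* As [0 <= cos d], replacing [|Y|] by [Y] or by [- Y] only increases the expression. The result is
   a combination of sines, of constant sign on the half-plane that contains the sector. *)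
have [mpi|mpi] := leP (m%:R * d) pi.
  have s1 : 0 <= sin (m%:R * d) by rewrite sin_ge0_pi //; lra.
  have s2 : 0 <= sin (m%:R * d - d) by rewrite sin_ge0_pi //; lra.
  apply: le_trans (_ : sin d * (a * cos (m%:R * d) + b * cos (m%:R * d + d)) - cos d * Y <= 0).
    by rewrite lerD2l lerN2 ler_wpM2l // ler_norm.
  rewrite (_ : _ - _ = - (a * sin (m%:R * d - d)) -
     b * (sin (m%:R * d) * (cos d ^+ 2 + sin d ^+ 2))); last first.
    by rewrite /Y sinB cosD sinD; ring.
  rewrite cos2Dsin2 mulr1; have := mulr_ge0 a0 s2; have := mulr_ge0 b0 s1; lra.
have s1 : 0 <= - sin (m%:R * d + d).
  rewrite -[_ + d](subrK pi) sinDpi opprK sin_ge0_pi //; lra.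
have s2 : 0 <= - sin (m%:R * d + d + d).
  rewrite -[_ + d + d](subrK pi) sinDpi opprK sin_ge0_pi //; lra.
apply: le_trans (_ : sin d * (a * cos (m%:R * d) + b * cos (m%:R * d + d)) + cos d * Y <= 0).
  rewrite lerD2l lerNl; rewrite -mulrN ler_wpM2l //.
  by rewrite -normrN ler_norm.
rewrite (_ : _ + _ = a * sin (m%:R * d + d) + b * sin (m%:R * d + d + d)); last first.
  by rewrite /Y (sinD (_ + d)) (cosD (m%:R * d)) (sinD (m%:R * d)); ring.
have := mulr_ge0 a0 s1; have := mulr_ge0 b0 s2; lra.
Qed.

(* Polar coordinates [(q.1, q.2)] on the [i]-th of [m] equal sectors. *)
Definition pie (R : realType) (m i : nat) (q : plane R) : plane R :=
  let a := 2 * pi * (i%:R + q.2) / m%:R in (q.1 * cos a, q.1 * sin a).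

Lemma cos_eq1 (R : realType) (x : R) : - (2 * pi) < x < 2 * pi -> cos x = 1 -> x = 0.
Proof.
move=> /andP[x1 x2]; rewrite (_ : x = x / 2 + x / 2); last by field.
rewrite cosD => h.
have s0 : sin (x / 2) = 0.
  have := cos2Dsin2 (x / 2) => h2; apply/eqP; rewrite -sqrf_eq0; apply/eqP; lra.
have p0 := @pi_gt0 R.
have [x0|x0|->//] := ltgtP (x / 2) 0.
- have : 0 < sin (- (x / 2)) by apply: sin_gt0_pi; apply/andP; split; lra.
  by rewrite sinN s0 oppr0 ltxx.
- have : 0 < sin (x / 2) by apply: sin_gt0_pi; apply/andP; split; lra.
  by rewrite s0 ltxx.
- by rewrite addr0.
Qed.

Lemma polar_inj (R : realType) (r r' a b : R) : 0 <= r -> 0 <= r' ->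
  r * cos a = r' * cos b -> r * sin a = r' * sin b ->
  r = r' /\ (0 < r -> 0 <= a < 2 * pi -> 0 <= b < 2 * pi -> a = b).
Proof.
move=> r0 r0' hc hs.
have rr : r = r'.
  apply/eqP; rewrite -(eqrXn2 (ltn0Sn 1)) //; apply/eqP.
  rewrite -[LHS]mulr1 -(cos2Dsin2 a) -[RHS]mulr1 -(cos2Dsin2 b).
  rewrite (_ : r ^+ 2 * _ = (r * cos a) ^+ 2 + (r * sin a) ^+ 2); last by ring.
  by rewrite hc hs; ring.
subst r'; split => // rp /andP[a0 a1] /andP[b0 b1].
have rn : r != 0 by rewrite gt_eqF.
move: hc hs => /(mulfI rn) hc /(mulfI rn) hs.
apply/eqP; rewrite -subr_eq0; apply/eqP; apply: cos_eq1; first lra.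
by rewrite cosB hc hs -(cos2Dsin2 b); ring.
Qed.

Lemma pie_surj (R : realType) (m : nat) (x y : R) : (0 < m)%N ->
  exists i r t, [/\ (i < m)%N, 0 <= r, 0 <= t <= 1, r ^+ 2 = x ^+ 2 + y ^+ 2 &
    pie m i (r, t) = (x, y)].
Proof.
move=> m0; have [r [a [r0 a0 -> ->]]] := polar x y.
have [i im /andP[i1 i2]] := truncn_sector m0 a0.
have p0 := @pi_gt0 R.
have mp : 0 < m%:R :> R by rewrite ltr0n.
have d0 : 0 < 2 * pi / m%:R :> R by rewrite divr_gt0 ?mulr_gt0.
exists i, r, (a / (2 * pi / m%:R) - i%:R); split => //.
- by rewrite subr_ge0 ler_pdivlMr // i1 lerBlDr ler_pdivrMr // addrC natr1.
- by rewrite -[LHS]mulr1 -(cos2Dsin2 a); ring.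
- rewrite /pie /= (_ : 2 * pi * _ / _ = a) //.
  have w0 : 2 * pi != 0 :> R by rewrite gt_eqF // mulr_gt0.
  move: (2 * pi) w0 => w w0; field.
  by rewrite w0 (gt_eqF mp).
Qed.

Lemma pie_inj (R : realType) (m i j : nat) (r r' t t' : R) : (i < m)%N -> (j < m)%N ->
  0 <= r -> 0 <= r' -> 0 <= t < 1 -> 0 <= t' < 1 ->
  pie m i (r, t) = pie m j (r', t') -> r = r' /\ (0 < r -> i = j /\ t = t').
Proof.
move=> im jm r0 r0' /andP[t0 t1] /andP[t0' t1'] [hc hs].
have p0 := @pi_gt0 R.
have mp : 0 < m%:R :> R by rewrite ltr0n; lia.
have rng k (s : R) : (k < m)%N -> 0 <= s -> s < 1 ->
    0 <= 2 * pi * (k%:R + s) / m%:R < 2 * pi.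
  move=> km s0 s1; apply/andP; split.
    rewrite divr_ge0 ?(ltW mp) //; apply: mulr_ge0; first lra.
    by rewrite addr_ge0 ?ler0n.
  rewrite ltr_pdivrMr // ltr_pM2l ?mulr_gt0 //.
  have : k%:R + 1 <= m%:R :> R by rewrite natr1 ler_nat.
  lra.
have [rr aa] := polar_inj r0 r0' hc hs; split => // rp.
have := aa rp (rng _ _ im t0 t1) (rng _ _ jm t0' t1').
have mn : m%:R != 0 :> R by rewrite gt_eqF.
have pn : 2 * pi != 0 :> R by rewrite gt_eqF // mulr_gt0.
move=> /(mulIf (invr_neq0 mn)) /(mulfI pn) e.
have ij : i = j.
  by apply/eqP; rewrite eqn_leq; apply/andP; split;
    rewrite -ltnS -(ltr_nat R) -natr1; lra.
by split=> //; move: e; rewrite ij => /addrI.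
Qed.

Lemma pie_next (R : realType) (m i : nat) (r : R) : (i < m)%N ->
  pie m i (r, 1) = pie m (i.+1 %% m) (r, 0).
Proof.
move=> im; rewrite /pie /= addr0 natr1.
case: (ltnP i.+1 m) => h; first by rewrite modn_small.
have -> : i.+1 = m by lia.
have mp : m%:R != 0 :> R by rewrite pnatr_eq0; lia.
rewrite modnn mulr0 mul0r mulfK // (_ : 2 * pi = 0 + pi *+ 2).
  by rewrite cosD2pi sinD2pi.
by rewrite mulr2n; ring.
Qed.

Lemma pie_continuous (R : realType) (m i : nat) : continuous (@pie R m i).
Proof.
have c1 : continuous (fun q : plane R => q.1) by move=> q; exact: cvg_fst.
have ca : continuous (fun q : plane R => 2 * pi * (i%:R + q.2) / m%:R).
  move=> q; apply: cvgM; last exact: cvg_cst.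
  apply: cvgM; first exact: cvg_cst.
  by apply: cvgD; [exact: cvg_cst|exact: cvg_snd].
have fc : continuous (fun q : plane R => q.1 * cos (2 * pi * (i%:R + q.2) / m%:R)).
  move=> q; apply: cvgM; first exact: c1.
  by apply: continuous_comp; [exact: ca|exact: continuous_cos].
have fs : continuous (fun q : plane R => q.1 * sin (2 * pi * (i%:R + q.2) / m%:R)).
  move=> q; apply: cvgM; first exact: c1.
  by apply: continuous_comp; [exact: ca|exact: continuous_sin].
by move=> q; exact: (cvg_pair (fc q) (fs q)).
Qed.

(** * Surfaces as simplicial complexes *)

Lemma index_next (T : eqType) (s : seq T) (y : T) : uniq s -> y \in s ->
  index (next s y) s = ((index y s).+1 %% size s)%N.
Proof.
case: s => [//|x s] us ys.
rewrite next_nth ys.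
set p := x :: s in us ys *; set i := index y p.
have ip : (i < size p)%N by rewrite index_mem.
case: (ltnP i.+1 (size p)) => h.
  by rewrite modn_small // -[nth _ _ _]/(nth x p i.+1) index_uniq.
have iE : i.+1 = size p by lia.
have ss : size s = i by case: iE.
rewrite -iE modnn nth_default ?ss // /p /=.
by rewrite eqxx.
Qed.

Lemma next_neq (T : eqType) (s : seq T) (y : T) : uniq s -> y \in s ->
  (1 < size s)%N -> next s y != y.
Proof.
move=> us ys s1; apply/eqP => e; have := index_next us ys; rewrite e.
have : (index y s < size s)%N by rewrite index_mem.
case: (ltnP (index y s).+1 (size s)) => h h'; first by rewrite modn_small; lia.
by rewrite (_ : (index y s).+1 = size s) ?modnn; lia.
Qed.

Section Complex.
Variables (R : realType) (X : finType) (link : X -> seq X).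

(* [link x] lists the neighbours of [x] in cyclic order; [tri x y z] means that
   [(x, y, z)] is a positively oriented triangle. *)
Definition tri x y z := (y \in link x) && (z == next (link x) y).

(** Each link is a simple cycle; [tri_rot] makes the links at the three corners of a triangle agree,
    with coherent orientations. The bound on the size keeps the angle of a sector within a right
    angle, as [tent_sector] requires. *)
Hypothesis link_uniq : forall x, uniq (link x).
Hypothesis link_size : forall x, (3 < size (link x))%N.
Hypothesis tri_rot : forall x y z, tri x y z -> tri y z x.

Lemma tri_mem2 x y z : tri x y z -> y \in link x. Proof. by case/andP. Qed.
Lemma tri_mem3 x y z : tri x y z -> z \in link x.
Proof. by case/andP => yx /eqP ->; rewrite mem_next. Qed.

Lemma tri_neq23 x y z : tri x y z -> y != z.
Proof.
case/andP=> yx /eqP ->; rewrite eq_sym next_neq //.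
exact: leq_trans (link_size x).
Qed.
Lemma tri_neq13 x y z : tri x y z -> x != z.
Proof. by move=> /tri_rot /tri_neq23; rewrite eq_sym. Qed.
Lemma tri_neq12 x y z : tri x y z -> x != y.
Proof. by move=> /tri_rot/tri_rot /tri_neq23. Qed.

Lemma tri_next x y : y \in link x -> tri x y (next (link x) y).
Proof. by move=> yx; rewrite /tri yx eqxx. Qed.

Lemma link_sym x y : y \in link x -> x \in link y.
Proof. by move=> /tri_next /tri_rot /tri_mem3. Qed.
Lemma notin_link x : x \notin link x.
Proof. by apply/negP => /tri_next /tri_neq12; rewrite eqxx. Qed.

Definition on_tri (p : X -> R) x y z := forall w, w \notin [:: x; y; z] -> p w = 0.

Definition cplx : set {ptws X -> R} :=
  [set p | [/\ forall x, 0 <= p x, \sum_x p x = 1 &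
    exists x y z, tri x y z /\ on_tri p x y z]].

Lemma on_tri_rot (p : X -> R) x y z : on_tri p x y z -> on_tri p y z x.
Proof. by move=> h w hw; apply: h; move: hw; rewrite !inE !negb_or => /and3P[-> -> ->]. Qed.

Lemma star_support p x : cplx p -> 0 < p x ->
  exists y z, tri x y z /\ on_tri p x y z.
Proof.
move=> [_ _ [a [b [c [t s]]]]] px.
have : x \in [:: a; b; c] by apply: contraTT px => /s ->; rewrite ltxx.
rewrite !inE => /or3P[] /eqP ->.
- by exists b, c.
- by exists c, a; split; [exact: tri_rot | exact: on_tri_rot].
- exists a, b; split; first exact/tri_rot/tri_rot.
  exact/on_tri_rot/on_tri_rot.
Qed.

Lemma sum_on_tri (p : X -> R) x y z : tri x y z -> on_tri p x y z ->
  \sum_w p w = p x + p y + p z.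
Proof.
move=> t s; rewrite (bigD1 x) //= (bigD1 y) /=; last by rewrite eq_sym (tri_neq12 t).
rewrite (bigD1 z) /=; last by rewrite eq_sym (tri_neq13 t) eq_sym (tri_neq23 t).
rewrite big1 ?addr0 ?addrA // => w /andP[/andP[wx wy] wz].
by apply: s; rewrite !inE !negb_or wx wy wz.
Qed.

Lemma sum_link_tri (F : X -> R) x y z : tri x y z ->
  (forall w, w \notin [:: y; z] -> w \in link x -> F w = 0) ->
  \sum_(w <- link x) F w = F y + F z.
Proof.
move=> t F0; rewrite (bigD1_seq y) ?(tri_mem2 t) ?link_uniq //=.
rewrite -big_filter (bigD1_seq z) /=; last 2 first.
- by rewrite mem_filter eq_sym (tri_neq23 t) (tri_mem3 t).
- by rewrite filter_uniq ?link_uniq.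
congr (_ + _); rewrite big_seq_cond big1 ?addr0 // => w /andP[].
rewrite mem_filter => /andP[wy wx] wz.
by apply: F0; rewrite // !inE negb_or wy.
Qed.

Lemma on_tri_link (p : X -> R) x y z w : on_tri p x y z -> w \in link x ->
  w \notin [:: y; z] -> p w = 0.
Proof.
move=> s wx; rewrite !inE negb_or => /andP[wy wz]; apply: s.
rewrite !inE !negb_or wy wz !andbT; apply: contraTN wx => /eqP ->.
exact: notin_link.
Qed.

(** * Charts on the open stars *)

Definition slice x : R := 2 * pi / (size (link x))%:R.
Definition ang x y : R := (index y (link x))%:R * slice x.
(** The link becomes a regular polygon. The vertex [x] sits at the origin, so its own coordinate
    drops out and the map is linear in [p]. *)
Definition chart_f x (p : X -> R) : plane R :=
  (\sum_(y <- link x) p y * cos (ang x y), \sum_(y <- link x) p y * sin (ang x y)).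
Definition tent_sum x (q : plane R) : R :=
  \sum_(y <- link x) tent (slice x) (ang x y) q.
(** The tents recover the coordinates on the link, and [x] receives what is missing to 1; hence the
    image of the open star is [tent_sum x q < 1]. *)
Definition chart_g x (q : plane R) : {ptws X -> R} := fun w =>
  if w == x then 1 - tent_sum x q
  else if w \in link x then tent (slice x) (ang x w) q else 0.

Lemma slice_bounds x : 0 < slice x <= pi / 2.
Proof.
have k4 : 4 <= (size (link x))%:R :> R by rewrite (ler_nat R 4).
have p0 := @pi_gt0 R.
apply/andP; split; first by rewrite divr_gt0 ?mulr_gt0 //; lra.
rewrite /slice ler_pdivrMr; last by lra.
rewrite (_ : pi / 2 * _ = pi * ((size (link x))%:R / 2)); last by ring.
by rewrite (mulrC 2) ler_pM2l //; lra.
Qed.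

Lemma sin_slice_gt0 x : 0 < sin (slice x).
Proof.
have p0 := @pi_gt0 R.
by have /andP[h1 h2] := slice_bounds x; apply: sin_gt0_pi; apply/andP; split; lra.
Qed.

Lemma ang_next x y z : tri x y z ->
  cos (ang x z) = cos (ang x y + slice x) /\ sin (ang x z) = sin (ang x y + slice x).
Proof.
case/andP=> yx /eqP ->; rewrite /ang index_next //.
have ik : (index y (link x) < size (link x))%N by rewrite index_mem.
have k0 : (0 < size (link x))%N by apply: leq_ltn_trans ik.
rewrite (_ : _ + slice x = (index y (link x)).+1%:R * slice x); last first.
  by rewrite -natr1; ring.
case: (ltnP (index y (link x)).+1 (size (link x))) => h; first by rewrite modn_small.
have -> : (index y (link x)).+1 = size (link x) by lia.
rewrite modnn mul0r /slice mulrC divfK ?pnatr_eq0 -?lt0n //.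
by rewrite -[2 * pi]add0r (_ : 2 * pi = pi *+ 2 :> R) ?cosD2pi ?sinD2pi // mulr2n; ring.
Qed.

Lemma chart_f_tri p x y z : tri x y z -> on_tri p x y z ->
  chart_f x p = (p y * cos (ang x y) + p z * cos (ang x z),
                 p y * sin (ang x y) + p z * sin (ang x z)).
Proof.
move=> t s; rewrite /chart_f.
by congr (_, _); apply: sum_link_tri => // w wn wx; rewrite (on_tri_link s wx wn) mul0r.
Qed.

Lemma sector x q : exists y z a b, [/\ tri x y z, 0 <= a, 0 <= b &
  q = (a * cos (ang x y) + b * cos (ang x z),
       a * sin (ang x y) + b * sin (ang x z))].
Proof.
case: q => q1 q2.
have [j [a [b [jk a0 b0 -> ->]]]] := plane_sector q1 q2 (ltnW (link_size x)).
have yx : nth x (link x) j \in link x by rewrite mem_nth.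
exists (nth x (link x) j), (next (link x) (nth x (link x) j)), a, b.
split => //; first exact: tri_next.
have [-> ->] := ang_next (tri_next yx).
rewrite /ang index_uniq ?link_uniq // -/(slice x).
by rewrite (_ : j.+1%:R * slice x = j%:R * slice x + slice x) // -natr1; ring.
Qed.

Lemma tent_tri x y z a b w : tri x y z -> 0 <= a -> 0 <= b -> w \in link x ->
  tent (slice x) (ang x w) (a * cos (ang x y) + b * cos (ang x z),
                          a * sin (ang x y) + b * sin (ang x z)) =
  if w == y then a else if w == z then b else 0.
Proof.
move=> t a0 b0 wx; have [-> ->] := ang_next t.
have yx := tri_mem2 t.
have jk : (index y (link x) < size (link x))%N by rewrite index_mem.
have lk : (index w (link x) < size (link x))%N by rewrite index_mem.
rewrite (_ : ang x y + slice x = (index y (link x)).+1%:R * slice x); last first.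
  by rewrite /ang -natr1; ring.
rewrite (tent_sector (link_size x) jk lk a0 b0).
have zE : z = next (link x) y by apply/eqP; case/andP: t.
rewrite -(index_next (link_uniq x) yx) -zE.
have ii u : u \in link x -> (index w (link x) == index u (link x)) = (w == u).
  by move=> ux; apply/eqP/eqP => [|->//]; exact: index_inj.
by rewrite !ii // (tri_mem3 t).
Qed.

Lemma sum_tent x y z a b : tri x y z -> 0 <= a -> 0 <= b ->
  tent_sum x (a * cos (ang x y) + b * cos (ang x z),
              a * sin (ang x y) + b * sin (ang x z)) = a + b.
Proof.
move=> t a0 b0; rewrite /tent_sum (sum_link_tri t).
  rewrite !(tent_tri t) ?(tri_mem2 t) ?(tri_mem3 t) // !eqxx.
  by rewrite eq_sym (negbTE (tri_neq23 t)).
move=> w; rewrite !inE negb_or => /andP[/negbTE wy /negbTE wz] wx.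
by rewrite (tent_tri t) // wy wz.
Qed.

Lemma chart_fK x p : cplx p -> 0 < p x ->
  tent_sum x (chart_f x p) < 1 /\ chart_g x (chart_f x p) = p.
Proof.
move=> cp px; have [y [z [t s]]] := star_support cp px.
have [p0 p1 _] := cp; rewrite (sum_on_tri t s) in p1.
rewrite (chart_f_tri t s); split; first by rewrite (sum_tent t) //; lra.
apply/funext => w; rewrite /chart_g (sum_tent t) //.
have [->|wx] := eqVneq w x; first by lra.
case: ifPn => wl.
  rewrite (tent_tri t) //; have [->//|wy] := eqVneq w y.
  have [->//|wz] := eqVneq w z.
  by rewrite s // !inE !negb_or wx wy wz.
rewrite s // !inE !negb_or wx /=.
apply/andP; split; apply: contra wl => /eqP ->;
  [exact: tri_mem2 t | exact: tri_mem3 t].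
Qed.

Lemma chart_gK x q : tent_sum x q < 1 ->
  [/\ cplx (chart_g x q), 0 < chart_g x q x & chart_f x (chart_g x q) = q].
Proof.
have [y [z [a [b [t a0 b0 ->]]]]] := sector x q.
set q' := (_, _) => ab; have sE : tent_sum x q' = a + b by exact: sum_tent.
rewrite sE in ab.
have yx := tri_neq12 t; have zx := tri_neq13 t.
have gx : chart_g x q' x = 1 - a - b by rewrite /chart_g eqxx sE; ring.
have gy : chart_g x q' y = a.
  by rewrite /chart_g eq_sym (negbTE yx) (tri_mem2 t) (tent_tri t) ?(tri_mem2 t)// eqxx.
have gz : chart_g x q' z = b.
  rewrite /chart_g eq_sym (negbTE zx) (tri_mem3 t) (tent_tri t) ?(tri_mem3 t)//.
  by rewrite eqxx eq_sym (negbTE (tri_neq23 t)).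
have s : on_tri (chart_g x q') x y z.
  move=> w; rewrite !inE !negb_or => /and3P[wx wy wz].
  rewrite /chart_g (negbTE wx); case: ifPn => // wl.
  by rewrite (tent_tri t) // (negbTE wy) (negbTE wz).
split; last 2 first.
- by rewrite gx; lra.
- by rewrite (chart_f_tri t s) gy gz.
split; last by exists x, y, z.
  move=> w; have [->|wx] := eqVneq w x; first by rewrite gx; lra.
  have [->|wy] := eqVneq w y; first by rewrite gy.
  have [->|wz] := eqVneq w z; first by rewrite gz.
  by rewrite s // !inE !negb_or wx wy wz.
by rewrite (sum_on_tri t s) gx gy gz; ring.
Qed.

Lemma big_continuous (Y : topologicalType) (s : seq X) (F : X -> Y -> R) :
  (forall w, continuous (F w)) -> continuous (fun q => \sum_(w <- s) F w q).
Proof.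
move=> cF q; elim: s => [|w s IH].
  rewrite (_ : (fun q => _) = cst 0); first exact: cvg_cst.
  by apply/funext => u; rewrite big_nil.
rewrite (_ : (fun q => _) = (fun q => F w q + \sum_(w <- s) F w q)).
  by apply: cvgD; [exact: cF|exact: IH].
by apply/funext => u; rewrite big_cons.
Qed.

Lemma tent_sum_continuous x : continuous (tent_sum x).
Proof. by apply: big_continuous => w; exact: tent_continuous. Qed.

Lemma chart_g_continuous x : continuous (chart_g x).
Proof.
apply: continuous_ptws => w; rewrite /chart_g.
case: eqP => _; last first.
  by case: (w \in link x); [exact: tent_continuous|move=> q; exact: cvg_cst].
by move=> q; apply: cvgB; [exact: cvg_cst|exact: tent_sum_continuous].
Qed.

Lemma chart_f_continuous x :
  continuous (chart_f x : {ptws X -> R} -> plane R).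
Proof.
have c (h : X -> R) :
    continuous (fun p : {ptws X -> R} => \sum_(y <- link x) p y * h y).
  apply: (@big_continuous _ _ (fun w (p : {ptws X -> R}) => p w * h w)) => w p.
  exact: (cvgM (@ptws_eval_continuous X R w p) (cvg_cst (h w))).
by move=> p; exact: (cvg_pair (c _ p) (c _ p)).
Qed.

Lemma cplx_vertex x : cplx (fun w => (w == x)%:R).
Proof.
have lx : nth x (link x) 0 \in link x by rewrite mem_nth ?(leq_trans _ (link_size x)).
split; first by move=> w; case: eqP => _ /=; lra.
  rewrite (bigD1 x) //= eqxx big1 ?addr0 // => w /negbTE -> //.
exists x, (nth x (link x) 0), (next (link x) (nth x (link x) 0)).
split; first exact: tri_next.
by move=> w; rewrite !inE !negb_or => /and3P[/negbTE ->].
Qed.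

Let S : topologicalType := set_type cplx.

(** Charts and parametrizations are total functions into a subtype; [p0] is the value off the
    complex. *)
Definition to_cplx (p0 : {ptws X -> R}) (p : {ptws X -> R}) (h0 : cplx p0) : S :=
  match pselect (cplx p) with
  | left h => exist _ p (mem_set h)
  | right _ => exist _ p0 (mem_set h0)
  end.

Lemma to_cplxE p0 p h0 : cplx p -> set_val (@to_cplx p0 p h0) = p.
Proof. by move=> h; rewrite /to_cplx; case: pselect. Qed.

Lemma cplxP (p : S) : cplx (set_val p).
Proof. by apply: set_mem; exact: (valP p). Qed.

Lemma to_cplxK p0 h0 (p : S) : @to_cplx p0 (set_val p) h0 = p.
Proof. by apply: val_inj; rewrite -[LHS]/(set_val _) to_cplxE //; exact: cplxP. Qed.

Lemma to_cplx_val p0 p h0 (s : S) : set_val s = p -> @to_cplx p0 p h0 = s.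
Proof. by move=> <-; exact: to_cplxK. Qed.

Lemma coord_continuous x : continuous (fun p : S => (set_val p : X -> R) x).
Proof.
move=> p; apply: (@continuous_comp S {ptws X -> R} R set_val (fun q => q x)).
  exact: set_val_continuous.
exact: (@ptws_eval_continuous X R x).
Qed.

Definition star x : set S := [set p | 0 < (set_val p : X -> R) x].
Definition star_cod x : set (plane R) := [set q | tent_sum x q < 1].
Definition star_map x (p : S) : plane R := chart_f x (set_val p).
Definition star_inv x (q : plane R) : S := to_cplx (chart_g x q) (cplx_vertex x).

Lemma star_open x : open (star x).
Proof.
apply: (@open_comp _ _ (fun p : S => (set_val p : X -> R) x) [set r | 0 < r]).
  by move=> p _; exact: coord_continuous.
exact: open_gt.
Qed.

Lemma star_cod_open x : open (star_cod x).
Proof.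
apply: (@open_comp _ _ (tent_sum x) [set r | r < 1]).
  by move=> p _; exact: tent_sum_continuous.
exact: open_lt.
Qed.

Lemma star_homeo x : homeomorphism_on (star x) (star_cod x) (star_map x) (star_inv x).
Proof.
split.
- move=> p px; have [h1 h2] := chart_fK (cplxP p) px.
  by split => //; apply: to_cplx_val.
- move=> q qx; have [h1 h2 h3] := chart_gK qx.
  by rewrite /star /star_map /= /star_inv to_cplxE.
- apply: continuous_subspaceT => p.
  apply: continuous_comp; first exact: set_val_continuous.
  exact: chart_f_continuous.
- apply: (to_set_type_within (g := chart_g x)).
    by move=> q qx; rewrite /star_inv to_cplxE //; case: (chart_gK qx).
  by apply: continuous_subspaceT; exact: chart_g_continuous.
Qed.

Definition star_chart x : chart R S :=
  @Chart R S _ _ _ _ (@star_open x) (@star_cod_open x) (@star_homeo x).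

Lemma star_cover (p : S) : exists x, star x p.
Proof.
have [p0 p1 _] := cplxP p.
apply: contrapT => /forallNP np; have : \sum_x (set_val p : X -> R) x = 0.
  apply: big1 => x _; apply/eqP; rewrite eq_le p0 andbT leNgt.
  by apply/negP; exact: np.
by rewrite p1 => /eqP; rewrite oner_eq0.
Qed.

(** A closed subset of a cube: the choice of the supporting triangle is a finite union of closed
    conditions. *)
Lemma cplx_compact : compact cplx.
Proof.
pose box := [set p : {ptws X -> R} | forall x : X, `[0, 1] (p x)].
have -> : cplx = box `&` ((fun p : {ptws X -> R} => \sum_x p x) @^-1` [set 1] `&`
    \bigcup_(t in [set t : X * X * X | tri t.1.1 t.1.2 t.2])
      \bigcap_(w in [set w | w \notin [:: t.1.1; t.1.2; t.2]])
         ((fun p : {ptws X -> R} => p w) @^-1` [set 0])).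
  rewrite eqEsubset; split=> p.
    move=> [p0 p1 [x [y [z [t s]]]]]; split.
      move=> w /=; rewrite in_itv /= p0 /= -p1 (bigD1 w) //= lerDl.
      by apply: sumr_ge0.
    split=> //; exists (x, y, z) => //= w; exact: s.
  move=> [pb [p1 [[[x y] z] /= t s]]]; split => //.
    by move=> w; have /= := pb w; rewrite in_itv /= => /andP[].
  by exists x, y, z; split => // w wn; exact: s.
apply: compact_closedI.
  apply: (@tychonoff X (fun=> R) (fun=> `[0, 1]%classic)) => _.
  exact: segment_compact.
apply: closedI.
  apply: (@preimage_closed _ _ (fun p : {ptws X -> R} => \sum_x p x)).
    move=> p _; apply: (@big_continuous _ _ (fun w (p : {ptws X -> R}) => p w)).
    by move=> w; exact: (@ptws_eval_continuous X R w).
  exact: closed_eq.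
apply: closed_bigcup; first exact: finite_finset.
move=> t _; apply: closed_bigI => w _.
apply: preimage_closed; last exact: closed_eq.
by move=> p _; exact: (@ptws_eval_continuous X R w).
Qed.


(** * Changes of charts *)

Lemma rot_coord_fst p x y z : tri x y z -> on_tri p x y z ->
  rotx (ang x y) (chart_f x p) = p y + cos (slice x) * p z /\
  roty (ang x y) (chart_f x p) = sin (slice x) * p z.
Proof.
move=> t s; rewrite (chart_f_tri t s) /rotx /roty /=.
have [-> ->] := ang_next t; rewrite cosD sinD.
have := cos2Dsin2 (ang x y); set C := cos (ang x y); set D := sin (ang x y) => CD.
split.
  rewrite (_ : _ + _ = (p y + cos (slice x) * p z) * (C ^+ 2 + D ^+ 2)); last by ring.
  by rewrite CD mulr1.
rewrite (_ : _ - _ = (sin (slice x) * p z) * (C ^+ 2 + D ^+ 2)); last by ring.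
by rewrite CD mulr1.
Qed.

Lemma rot_coord_snd p x y z : tri x y z -> on_tri p x y z ->
  rotx (ang x z) (chart_f x p) = p z + cos (slice x) * p y /\
  roty (ang x z) (chart_f x p) = - (sin (slice x) * p y).
Proof.
move=> t s; rewrite (chart_f_tri t s) /rotx /roty /=.
have [-> ->] := ang_next t; rewrite cosD sinD.
have := cos2Dsin2 (ang x y); set C := cos (ang x y); set D := sin (ang x y) => CD.
have := cos2Dsin2 (slice x); set c := cos (slice x); set d := sin (slice x) => cd.
split.
  rewrite (_ : _ + _ = (c * p y + p z * (c ^+ 2 + d ^+ 2)) * (C ^+ 2 + D ^+ 2)); last by ring.
  by rewrite CD cd; ring.
rewrite (_ : _ - _ = - (d * p y) * (C ^+ 2 + D ^+ 2)); last by ring.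
by rewrite CD mulr1.
Qed.

(* In rotated coordinates the change of star charts across the edge [xy] is
   [(X, Y) |-> (1 - X + kappa |Y|, - mu Y)]. *)
Definition fold_kappa x y : R := (cos (slice x) + cos (slice y) - 1) / sin (slice x).
Definition fold_mu x y : R := sin (slice y) / sin (slice x).

(** A point with positive coordinates at both ends lies in one of the two triangles on the edge.
    These lie on opposite sides of the axis, so the absolute value merges the two linear formulas;
    [kappa] comes from eliminating [p x] by means of [p x + p y + p z = 1]. *)
Lemma transition_coord p x y : cplx p -> 0 < p x -> 0 < p y -> y \in link x ->
  let q := chart_f x p in let q' := chart_f y p in
  rotx (ang y x) q' = 1 - rotx (ang x y) q + fold_kappa x y * `|roty (ang x y) q| /\
  roty (ang y x) q' = - (fold_mu x y * roty (ang x y) q).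
Proof.
move=> cp px py yx q q'.
have [a [b [t s]]] := star_support cp px.
have [p0 p1 _] := cp; rewrite (sum_on_tri t s) in p1.
have sx := sin_slice_gt0 x.
have : y \in [:: a; b].
  have : y \in [:: x; a; b] by apply: contraTT py => /s ->; rewrite ltxx.
  rewrite inE => /orP[/eqP yE|//]; by move: yx; rewrite yE (negbTE (notin_link x)).
rewrite !inE => /orP[] /eqP yE; subst y.
  have [h1 h2] := rot_coord_fst t s.
  have [h3 h4] := rot_coord_snd (tri_rot t) (on_tri_rot s).
  rewrite /q /q' h1 h2 h3 h4 normrM (gtr0_norm sx) (ger0_norm (p0 b)).
  rewrite /fold_kappa /fold_mu (_ : p x = 1 - p a - p b); last by rewrite -p1; ring.
  by split; field; rewrite gt_eqF.
have [h1 h2] := rot_coord_snd t s.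
have [h3 h4] := rot_coord_fst (tri_rot (tri_rot t)) (on_tri_rot (on_tri_rot s)).
rewrite /q /q' h1 h2 h3 h4 normrN normrM (gtr0_norm sx) (ger0_norm (p0 a)).
rewrite /fold_kappa /fold_mu (_ : p x = 1 - p a - p b); last by rewrite -p1; ring.
by split; field; rewrite gt_eqF.
Qed.

Lemma rotK (psi : R) q :
  q = (cos psi * rotx psi q - sin psi * roty psi q,
       sin psi * rotx psi q + cos psi * roty psi q).
Proof.
case: q => q1 q2; rewrite /rotx /roty /=.
have := cos2Dsin2 psi; set C := cos psi; set D := sin psi => CD.
congr (_, _).
  by rewrite -[LHS]mulr1 -CD; ring.
by rewrite -[LHS]mulr1 -CD; ring.
Qed.

(** The change of charts extended to the whole plane, so that its winding number can be computed
    without regard to the overlap. *)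
Definition fold x y (q : plane R) : plane R :=
  let u := 1 - rotx (ang x y) q + fold_kappa x y * `|roty (ang x y) q| in
  let v := - (fold_mu x y * roty (ang x y) q) in
  (cos (ang y x) * u - sin (ang y x) * v, sin (ang y x) * u + cos (ang y x) * v).

Lemma winds_once_transition x y (q : plane R) (r : R) : 0 < r ->
  winds_once (fun t => fold x y (q.1 + r * cos t, q.2 + r * sin t)) (fold x y q).
Proof.
move=> r0.
have mu0 : 0 < fold_mu x y by rewrite divr_gt0 ?sin_slice_gt0.
(* The displacement is minus the one treated by [winds_once_fold]; the sign is the angle [pi] added
   to [ang y x]. *)
have := @winds_once_fold R (fold x y q) (ang y x + pi) (ang x y) (fold_mu x y)
  (fold_kappa x y) (roty (ang x y) q) r mu0 r0.
congr winds_once; apply/funext => t.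
rewrite cosD sinD cospi sinpi !(cosB t) !(sinB t) /fold.
have -> : rotx (ang x y) (q.1 + r * cos t, q.2 + r * sin t) = rotx (ang x y) q +
    r * (cos t * cos (ang x y) + sin t * sin (ang x y)) by rewrite /rotx /=; ring.
have -> : roty (ang x y) (q.1 + r * cos t, q.2 + r * sin t) = roty (ang x y) q +
    r * (sin t * cos (ang x y) - cos t * sin (ang x y)) by rewrite /roty /=; ring.
by congr (_, _); rewrite /=; ring.
Qed.

Lemma star_overlap (p : S) x y : star x p -> star y p -> x != y -> y \in link x.
Proof.
move=> px py xy; have [a [b [t s]]] := star_support (cplxP p) px.
have : y \in [:: x; a; b] by apply: contraTT py => /s; rewrite /star /= => ->; rewrite ltxx.
rewrite !inE eq_sym (negbTE xy) /= => /orP[] /eqP ->;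
  by [exact: tri_mem2 t | exact: tri_mem3 t].
Qed.

(** Seen in the chart at [x], the overlap is where the tent of [y] is positive. Openness makes
    sufficiently small circles stay where the transition coincides with [fold]. *)
Lemma overlap_open x y : y \in link x ->
  open (star_map x @` (star x `&` star y)).
Proof.
move=> yx; have -> : star_map x @` (star x `&` star y) = star_cod x `&`
    (tent (slice x) (ang x y)) @^-1` [set r | 0 < r].
  have yx' : y != x by apply: contraTN yx => /eqP ->; exact: notin_link.
  have gE q : chart_g x q y = tent (slice x) (ang x y) q.
    by rewrite /chart_g (negbTE yx') yx.
  have [h1 h2 _ _] := star_homeo x.
  rewrite eqEsubset; split=> q.
    move=> [p [px py] <-]; have [cpx e] := h1 _ px; split => //.
    rewrite /= -gE; move: py; rewrite -{1}e /star /= to_cplxE //.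
    by case: (chart_gK cpx).
  move=> [qx /= q0]; have [ix e] := h2 _ qx; exists (star_inv x q) => //; split => //.
  rewrite /star /= /star_inv to_cplxE ?gE //.
  by case: (chart_gK qx).
apply: openI; first exact: star_cod_open.
apply: open_comp; last exact: open_gt.
by move=> q _; exact: tent_continuous.
Qed.

Lemma circle_near (W : set (plane R)) (p : plane R) : open W -> W p ->
  \forall r \near 0^'+, forall t, W (p.1 + r * cos t, p.2 + r * sin t).
Proof.
move=> oW Wp; have /nbhs_ballP[e /= e0 sW] : nbhs p W by exact: open_nbhs_nbhs.
near=> r => t; apply: sW.
have r0 : 0 < r by near: r; exact: nbhs_right_gt.
have re : r < e by near: r; exact: nbhs_right_lt.
split; rewrite /ball /= opprD addNKr normrN normrM (gtr0_norm r0);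
  apply: le_lt_trans re; apply: ler_piMr; rewrite ?(ltW r0) ?cos_max ?sin_max //.
Unshelve. all: by end_near. Qed.

Lemma star_transition x y : orientation_preserving
  (star_map x @` (star x `&` star y)) (star_map y \o star_inv x).
Proof.
move=> p Wp.
have [h1 h2 _ _] := star_homeo x.
have [yE|yx] := eqVneq x y.
  subst y; have oW : open (star_map x @` (star x `&` star x)).
    rewrite setIid; have -> : star_map x @` star x = star_cod x.
      rewrite eqEsubset; split=> q; first by move=> [s /h1[? _] <-].
      by move=> /h2[? e]; exists (star_inv x q).
    exact: star_cod_open.
  have fE q : (star_map x @` (star x `&` star x)) q ->
      (star_map x \o star_inv x) q = q.
    by move=> [s [sx _] <-] /=; have [_ ->] := h1 _ sx.
  have := circle_near oW Wp; have := @nbhs_right_gt R 0.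
  apply: filterS2 => r r0 rW.
  rewrite (fE _ Wp); exists (fun=> r), id; split.
  - by apply: continuous_subspaceT => t; exact: cvg_id.
  - by rewrite add0r.
  by move=> t _; split => //; rewrite fE.
have xy : y \in link x by case: Wp => s [sx sy] _; exact: star_overlap sx sy yx.
have fE q : (star_map x @` (star x `&` star y)) q ->
    (star_map y \o star_inv x) q = fold x y q.
  move=> [s [sx sy] <-] /=; have [_ ->] := h1 _ sx.
  rewrite [LHS](rotK (ang y x)) /fold /star_map.
  by have [-> ->] := transition_coord (cplxP s) sx sy xy.
have := circle_near (overlap_open xy) Wp; have := @nbhs_right_gt R 0.
apply: filterS2 => r r0 rW.
rewrite (fE _ Wp); have := winds_once_transition x y p r0.
by congr winds_once; apply/funext => t; rewrite fE.
Qed.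

Lemma cplx_orientable : orientable R S.
Proof.
exists (range star_chart); split.
  by move=> p; have [x xp] := star_cover p; exists (star_chart x).
by move=> _ _ [x _ <-] [y _ <-]; exact: star_transition.
Qed.

(** * Connectedness and the surface axioms *)

Lemma segment_component (p q : S) :
  (forall t, 0 <= t <= 1 ->
     cplx (fun x => (1 - t) * (set_val p : X -> R) x + t * (set_val q : X -> R) x)) ->
  connected_component [set: S] p q.
Proof.
move=> cpq.
pose f (t : R) : {ptws X -> R} :=
  fun x => (1 - t) * (set_val p : X -> R) x + t * (set_val q : X -> R) x.
pose g t := to_cplx (f t) (cplxP p).
have g0 : g 0 = p.
  apply: to_cplx_val; apply/funext => x; rewrite /f; ring.
have g1 : g 1 = q.
  apply: to_cplx_val; apply/funext => x; rewrite /f; ring.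
have cg : {within `[0, 1], continuous g}.
  apply: (to_set_type_within (g := f)).
    move=> t /=; rewrite in_itv /= => t01.
    by rewrite /g /= to_cplxE //; exact: cpq.
  apply: continuous_subspaceT; apply: continuous_ptws => x t.
  apply: cvgD; apply: cvgM.
  - by apply: cvgB; [exact: cvg_cst|exact: cvg_id].
  - exact: cvg_cst.
  - exact: cvg_id.
  - exact: cvg_cst.
exists (g @` `[0, 1]); last by exists 1; rewrite //= in_itv /= ler01 lexx.
split => //; first by exists 0; rewrite //= in_itv /= ler01 lexx.
apply: connected_continuous_connected => //.
exact: segment_connected.
Qed.

Hypothesis link_connected : forall x y, connect (fun x y => y \in link x) x y.

Definition vertex x : S :=
  exist _ ((fun w => (w == x)%:R) : {ptws X -> R}) (mem_set (cplx_vertex x)).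

Lemma vertexE x w : (set_val (vertex x) : X -> R) w = (w == x)%:R. Proof. by []. Qed.

Lemma vertex_component (p : S) x : star x p ->
  connected_component [set: S] p (vertex x).
Proof.
move=> px; apply: segment_component => t /andP[t0 t1].
have [p0 p1 _] := cplxP p; have [y [z [tr s]]] := star_support (cplxP p) px.
have [v0 v1 _] := cplxP (vertex x); split.
- by move=> w; rewrite addr_ge0 ?mulr_ge0 //; lra.
- by rewrite big_split /= -!mulr_sumr p1 v1; ring.
exists x, y, z; split => // w wn; rewrite s // mulr0 add0r vertexE.
by move: wn; rewrite !inE !negb_or => /and3P[/negbTE -> _ _]; rewrite mulr0.
Qed.

Lemma adj_component x y : y \in link x ->
  connected_component [set: S] (vertex x) (vertex y).
Proof.
move=> yx; pose h : {ptws X -> R} := fun w => (w == x)%:R / 2 + (w == y)%:R / 2.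
have xy : x != y by apply: contraTneq yx => <-; exact: notin_link.
have hs : on_tri h x y (next (link x) y).
  move=> w; rewrite !inE !negb_or /h => /and3P[/negbTE -> /negbTE -> _].
  by rewrite !mul0r addr0.
have ch : cplx h.
  split; last by exists x, y, (next (link x) y); split => //; exact: tri_next.
    by move=> w; rewrite addr_ge0 // divr_ge0.
  have z1 := tri_neq13 (tri_next yx); have z2 := tri_neq23 (tri_next yx).
  rewrite (sum_on_tri (tri_next yx) hs) /h !eqxx (negbTE xy).
  by rewrite (eq_sym y x) !(eq_sym (next _ _)) (negbTE xy) (negbTE z1) (negbTE z2) /=; lra.
pose p : S := exist _ h (mem_set ch).
apply: (@connected_component_trans _ _ p).
  apply: connected_component_sym; apply: vertex_component.
  suff : 0 < h x by [].
  by rewrite /h eqxx (negbTE xy) /=; lra.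
apply: vertex_component.
suff : 0 < h y by [].
by rewrite /h eqxx eq_sym (negbTE xy) /=; lra.
Qed.

Lemma cplx_connected : connected [set: S].
Proof.
have [->|/set0P[p _]] := eqVneq [set: S] set0; first exact: connected0.
have -> : [set: S] = connected_component [set: S] p.
  rewrite eqEsubset; split => // q _.
  have [x px] := star_cover p; have [y qy] := star_cover q.
  apply: (@connected_component_trans _ _ (vertex x)).
    exact: vertex_component.
  apply: (@connected_component_trans _ _ (vertex y)); last first.
    by apply: connected_component_sym; exact: vertex_component.
  have /connectP[s ps ->] := link_connected x y.
  elim: s x ps {px} => [|z s IH] x /=.
    by move=> _; exact: connected_component_refl.
  move=> /andP[xz zs]; apply: (@connected_component_trans _ _ (vertex z)).
    exact: adj_component.
  exact: IH.
exact: component_connected.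
Qed.

Lemma cplx_hausdorff : hausdorff_space S.
Proof.
apply: set_type_hausdorff; apply: hausdorff_product => _; exact: norm_hausdorff.
Qed.

Lemma cplx_surface : surface R S.
Proof.
split.
- exact: cplx_hausdorff.
- exact: set_type_compact cplx_compact.
- exact: cplx_connected.
- by move=> p; have [x xp] := star_cover p; exists (star_chart x).
Qed.
End Complex.

(** * The complex of a combinatorial map *)

Lemma uniq_flatten (T U : eqType) (f : T -> seq U) (s : seq T) : uniq s ->
  {in s, forall x, uniq (f x)} ->
  {in s &, forall x y u, u \in f x -> u \in f y -> x = y} ->
  uniq (flatten [seq f x | x <- s]).
Proof.
elim: s => //= x s IH /andP[xs us] uf disj.
rewrite cat_uniq uf ?mem_head // IH //; last 2 first.
- by move=> y ys; apply: uf; rewrite inE ys orbT.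
- by move=> y z ys zs; apply: disj; rewrite inE ?ys ?zs orbT.
rewrite andbT /=; apply/hasPn => u /flatten_mapP[y ys uy].
apply/negP => ux; move: xs; rewrite (disj x y _ _ u) ?ys ?mem_head //.
by rewrite inE ys orbT.
Qed.

Lemma cycle_flatten3 (T U : eqType) (f : T -> T) (e : rel U) (a b c : T -> U)
    (s : seq T) : fcycle f s ->
  {in s, forall x, [&& e (a x) (b x), e (b x) (c x) & e (c x) (a (f x))]} ->
  cycle e (flatten [seq [:: a x; b x; c x] | x <- s]).
Proof.
case: s => //= x s fs es.
have [exab exbc _] := and3P (es _ (mem_head _ _)).
rewrite exab exbc /=.
have : path e (c x) (rcons (flatten [seq [:: a y; b y; c y] | y <- s]) (a (f (last x s)))).
  move: fs es; rewrite rcons_path => /andP[fs _] {exab exbc}.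
  elim: s x fs => [|y s IH] x /=.
    by move=> _ /(_ _ (mem_head _ _)) /and3P[_ _ ->].
  move=> /andP[/eqP fx fs] es.
  have /and3P[_ _ h1] := es _ (mem_head _ _).
  have ys : y \in [:: x, y & s] by rewrite !inE eqxx orbT.
  have /and3P[h2 h3 _] := es _ ys.
  rewrite -fx h1 /= fx h2 h3 /=; apply: IH => // z zs.
  by apply: es; rewrite inE zs orbT.
by move: fs; rewrite rcons_path => /andP[_ /eqP ->].
Qed.

Lemma in_unit (R : realType) (t : R) :
  (t \in `[0, 1]%classic) = (0 <= t <= 1).
Proof. by apply/idP/idP; rewrite inE /= in_itv. Qed.

Lemma fpath_belast (T : eqType) (f : T -> T) x (s : seq T) :
  fpath f x s -> s = [seq f y | y <- belast x s].
Proof. by elim: s x => //= y s IH x /andP[/eqP -> /IH <-]. Qed.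

Lemma rot1_fcycle (T : eqType) (f : T -> T) (s : seq T) :
  fcycle f s -> rot 1 s = [seq f x | x <- s].
Proof.
by case: s => // x s /fpath_belast; rewrite rot1_cons belast_rcons.
Qed.

Lemma set2_eq (T : finType) (a b c d : T) : a != b ->
  [set a; b]%SET = [set c; d]%SET -> (a = c /\ b = d) \/ (a = d /\ b = c).
Proof.
move=> ab E.
have : a \in [set c; d]%SET by rewrite -E set21.
have : b \in [set c; d]%SET by rewrite -E set22.
by rewrite !in_set2 => /orP[] /eqP bE /orP[] /eqP aE; subst; auto;
  rewrite eqxx in ab.
Qed.

Lemma sum_delta (R : realType) (T : finType) (u : T) :
  \sum_(w : T) (w == u)%:R = 1 :> R.
Proof. by rewrite (bigD1 u) //= eqxx big1 ?addr0 // => w /negbTE ->. Qed.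

Section Map.
Variables (V D : finType) (e : rel V) (tl : D -> V) (rev fnx : D -> D).
Variable col : D -> bool.
Definition hd d := tl (rev d).
Hypothesis revK : involutive rev.
Hypothesis fnx_inj : injective fnx.
Hypothesis tl_fnx : forall d, tl (fnx d) = hd d.
Hypothesis col_fnx : forall d, col (fnx d) = col d.
Hypothesis col_rev : forall d, col (rev d) = ~~ col d.
Hypothesis dart_edge : forall u v, e u v -> exists2 d, tl d = u & hd d = v.
Hypothesis edge_dart : forall d, e (tl d) (hd d).
Hypothesis e_irr : irreflexive e.
Hypothesis dart_inj : forall d d', tl d = tl d' -> hd d = hd d' -> d = d'.
(** The link of a face centre consists of the dart points of the face, so at least four are
    required. *)
Hypothesis face_size : forall d, (3 < order fnx d)%N.
Hypothesis vertex_dart : forall v, exists d, tl d == v.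
(** The darts leaving a vertex form a single cycle, so that the link of the vertex is one circle and
    no two discs are pinched together there. *)
Hypothesis rotation : forall d d', tl d = tl d' ->
  fconnect (fun d => rev (finv fnx d)) d d'.
Hypothesis e_connected : forall u v, connect e u v.

(** * Cells, oriented triangles and links *)

Definition fpr := finv fnx.
Definition vnx d := rev (fpr d).

Lemma fprK : cancel fpr fnx. Proof. exact: f_finv. Qed.
Lemma fnxK : cancel fnx fpr. Proof. exact: finv_f. Qed.
Lemma fpr_inj : injective fpr. Proof. exact: can_inj fprK. Qed.
Lemma hd_fpr d : hd (fpr d) = tl d. Proof. by rewrite -tl_fnx fprK. Qed.
Lemma hd_rev d : hd (rev d) = tl d. Proof. by rewrite /hd revK. Qed.
Lemma vnx_inj : injective vnx.
Proof. by move=> d d' h; apply/fpr_inj/(can_inj revK). Qed.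
Lemma tl_vnx d : tl (vnx d) = tl d. Proof. by rewrite -[tl (vnx d)]/(hd _) hd_fpr. Qed.
Lemma hd_vnx d : hd (vnx d) = tl (fpr d). Proof. by rewrite hd_rev. Qed.
Lemma tl_neq_hd d : tl d != hd d.
Proof. by apply/eqP => h; have := edge_dart d; rewrite h e_irr. Qed.

Lemma fnx2_neq d : fnx (fnx d) != d.
Proof.
apply/eqP => h; have := face_size d; suff : (order fnx d <= 2)%N by lia.
by apply: (@order_le_cycle _ fnx [:: d; fnx d]); rewrite ?mem_head //= h !eqxx.
Qed.

(** A face is encoded by the root dart of its [fnx]-orbit, which also fixes where its boundary walk
    starts. *)
Definition face_type := {d : D | froot fnx d == d}.
Definition cell := (V + (D + face_type))%type.
Definition cV (v : V) : cell := inl v.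
Definition cD (d : D) : cell := inr (inl d).
Definition cF (f : face_type) : cell := inr (inr f).

Lemma fconn_sym : connect_sym (frel fnx).
Proof. exact: fconnect_sym. Qed.

Definition face_of (d : D) : face_type :=
  exist _ (froot fnx d) (introT eqP (root_root fconn_sym d)).

Lemma face_of_eq d d' : (face_of d == face_of d') = fconnect fnx d d'.
Proof. by rewrite -val_eqE /= root_connect //; exact: fconn_sym. Qed.
Lemma face_of_fnx d : face_of (fnx d) = face_of d.
Proof. by apply/eqP; rewrite face_of_eq fconn_sym fconnect1. Qed.
Lemma face_of_fpr d : face_of (fpr d) = face_of d.
Proof. by rewrite -{2}[d]fprK face_of_fnx. Qed.
Lemma face_of_val f : face_of (val f) = f.
Proof. by apply: val_inj; apply/eqP; exact: (valP f). Qed.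

(** The nine patterns are the three kinds of triangle, each in its three cyclic rotations, so that
    invariance under rotation holds by computation. *)
Definition mtri (x y z : cell) : bool :=
  match x, y, z with
  | inl u, inl v, inr (inl d) => (tl d == u) && (hd d == v)
  | inl v, inr (inl d), inl u => (tl d == u) && (hd d == v)
  | inr (inl d), inl u, inl v => (tl d == u) && (hd d == v)
  | inr (inl d), inl v, inr (inl d') => (hd d == v) && (fnx d == d')
  | inl v, inr (inl d'), inr (inl d) => (hd d == v) && (fnx d == d')
  | inr (inl d'), inr (inl d), inl v => (hd d == v) && (fnx d == d')
  | inr (inr f), inr (inl d), inr (inl d') => (face_of d == f) && (fnx d == d')
  | inr (inl d), inr (inl d'), inr (inr f) => (face_of d == f) && (fnx d == d')
  | inr (inl d'), inr (inr f), inr (inl d) => (face_of d == f) && (fnx d == d')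
  | _, _, _ => false
  end.

Lemma mtri_rot x y z : mtri x y z -> mtri y z x.
Proof. by case: x => [u|[d|f]]; case: y => [v|[d'|g]]; case: z => [w|[d''|h]]. Qed.

(** An oriented edge has one triangle on its left. Different kinds of triangle are kept apart by the
    absence of loops and of faces of length two; within one kind, [dart_inj] or [fnx_inj]
    decides. *)
Lemma mtri_fun x y z z' : mtri x y z -> mtri x y z' -> z = z'.
Proof.
have c1 d : tl d <> hd d by apply/eqP; exact: tl_neq_hd.
have c2 d : fnx (fnx d) <> d by apply/eqP; exact: fnx2_neq.
case: x => [u|[d|f]]; case: y => [v|[d'|g]]; case: z => [w|[d''|h]] //=;
  case: z' => [w'|[c|h']] //= /andP[/eqP h1 /eqP h2] /andP[/eqP h3 /eqP h4];
  repeat match goal with d : Finite.sort D |- _ =>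
    match goal with
    | H : tl d <> hd d |- _ => fail 1
    | _ => pose proof (c1 d); pose proof (c2 d); pose proof (tl_fnx d)
    end end;
  solve [congruence | do 2 f_equal; apply: dart_inj; congruence
        | do 2 f_equal; apply: fnx_inj; congruence].
Qed.

Definition out v := xchoose (vertex_dart v).
Lemma tl_out v : tl (out v) = v.
Proof. by apply/eqP; exact: (xchooseP (vertex_dart v)). Qed.

(** At a vertex, each outgoing dart [d] contributes its other end, its own point, and the point of
    the dart that precedes it on its face; [vnx] then leads to the next edge. *)
Definition link (x : cell) : seq cell :=
  match x with
  | inl v => flatten [seq [:: cV (hd d); cD d; cD (fpr d)] | d <- orbit vnx (out v)]
  | inr (inl d) => [:: cV (tl d); cV (hd d); cD (fnx d); cF (face_of d); cD (fpr d)]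
  | inr (inr f) => [seq cD d | d <- orbit fnx (val f)]
  end.

Lemma mem_orbit_out d v : (d \in orbit vnx (out v)) = (tl d == v).
Proof.
rewrite -fconnect_orbit; apply/idP/eqP => [|dv].
  move=> /iter_findex <-; elim: (findex _ _ _) => [|i IH] /=; first exact: tl_out.
  by rewrite tl_vnx.
by apply: rotation; rewrite tl_out.
Qed.

Lemma mem_orbit_face d (f : face_type) : (d \in orbit fnx (val f)) = (face_of d == f).
Proof. by rewrite -fconnect_orbit -face_of_eq face_of_val eq_sym. Qed.

Lemma link_cycle x : cycle (mtri x) (link x).
Proof.
case: x => [v|[d|f]].
- apply: (@cycle_flatten3 _ _ vnx); first exact: cycle_orbit vnx_inj _.
  move=> d; rewrite mem_orbit_out => /eqP dv /=.
  by rewrite !eqxx hd_fpr dv hd_vnx fprK !eqxx.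
- by rewrite /= !eqxx hd_fpr face_of_fpr fprK !eqxx.
- rewrite /= cycle_map; apply: (@sub_in_cycle _ (mem (orbit fnx (val f))) (frel fnx)).
  + move=> x y /=; rewrite !mem_orbit_face => /eqP xf _ /= /eqP <-.
    by rewrite xf !eqxx.
  + exact/allP.
  + exact: cycle_orbit fnx_inj _.
Qed.

Lemma mtri_mem x y z : mtri x y z -> y \in link x.
Proof.
case: x => [u|[d|f]]; case: y => [v|[d'|g]]; case: z => [w|[d''|h]] //=
  /andP[/eqP h1 /eqP h2]; subst => //; rewrite ?inE ?eqxx ?orbT //.
- by apply/flatten_mapP; exists d''; rewrite ?mem_orbit_out ?inE ?eqxx.
- apply/flatten_mapP; exists (fnx d'); rewrite ?mem_orbit_out ?tl_fnx //.
  by rewrite !inE fnxK eqxx !orbT.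
- by apply/flatten_mapP; exists (fnx d''); rewrite ?mem_orbit_out ?tl_fnx // !inE eqxx orbT.
- by rewrite fnxK eqxx !orbT.
- by rewrite face_of_fnx eqxx !orbT.
- by rewrite map_f // mem_orbit_face.
Qed.

Lemma fpr_neq_fnx d : fpr d != fnx d.
Proof. by rewrite -(inj_eq fnx_inj) fprK eq_sym fnx2_neq. Qed.

Lemma fpr_neq d : d != fpr d.
Proof.
by apply/eqP => h; have := tl_neq_hd (fpr d); rewrite hd_fpr -h eqxx.
Qed.

Lemma link_uniq x : uniq (link x).
Proof.
case: x => [v|[d|f]].
- apply: uniq_flatten; first exact: orbit_uniq.
    by move=> d _; rewrite /= !inE !andbT; exact: fpr_neq.
  have nn d d' : tl d = v -> tl d' = v -> cD d != cD (fpr d').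
    move=> dv dv'; apply/eqP => -[dd]; have := tl_neq_hd d.
    by rewrite {2}dd hd_fpr dv dv' eqxx.
  move=> d d'; rewrite !mem_orbit_out => /eqP dv /eqP dv' u.
  rewrite !inE => /or3P[] /eqP -> /or3P[] // /eqP.
  + by case=> h; apply: dart_inj => //; rewrite dv.
  + by case.
  + by move/eqP; rewrite (negbTE (nn _ _ dv dv')).
  + by move/eqP; rewrite eq_sym (negbTE (nn _ _ dv' dv)).
  + by case=> /fpr_inj.
- rewrite /= !inE !andbT !negb_or /= (_ : (cV (tl d) == cV (hd d)) = false) /=; last first.
    by apply/negbTE; exact: tl_neq_hd.
  by rewrite -[cD _ == cD _]/(fnx d == fpr d) eq_sym fpr_neq_fnx.
- by rewrite map_inj_uniq ?orbit_uniq // => d d' [].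
Qed.

(** Colours alternate around a vertex, since [fnx] keeps the colour and [rev] changes it; a rotation
    of order one would contradict this. *)
Lemma vnx_order d : (1 < order vnx d)%N.
Proof.
have := order_gt0 vnx d; case o : (order vnx d) => [|[|k]] // _.
have := iter_order vnx_inj d; rewrite o /= => h.
have := col_rev (fpr d); rewrite -/(vnx d) h -{1}(fprK d) col_fnx.
by case: (col _).
Qed.

Lemma link_size x : (3 < size (link x))%N.
Proof.
case: x => [v|[d|f]] //=; last by rewrite size_map size_orbit.
have := vnx_order (out v); rewrite -size_orbit.
by case: (orbit _ _) => [|d [|d' s]] //=.
Qed.

(** [link_cycle] makes the successor in a link a third corner, and [mtri_fun] makes that corner
    unique. *)
Lemma mtriP x y z : tri link x y z <-> mtri x y z.
Proof.
split=> [/andP[yx /eqP ->]|h]; first exact: next_cycle (link_cycle x) yx.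
have yx := mtri_mem h; rewrite /tri yx /=; apply/eqP.
exact: mtri_fun h (next_cycle (link_cycle x) yx).
Qed.

Lemma link_rot x y z : tri link x y z -> tri link y z x.
Proof. by move=> /mtriP /mtri_rot /mtriP. Qed.

Lemma link_connected x y : connect (fun x y => y \in link x) x y.
Proof.
have lsym a b : b \in link a -> a \in link b.
  exact: (link_sym link_rot).
have sym : connect_sym (fun x y => y \in link x).
  by apply: sym_connect_sym => a b; apply/idP/idP; exact: lsym.
suff to_v a : exists u, connect (fun x y => y \in link x) a (cV u).
  have [u xu] := to_v x; have [v yv] := to_v y.
  apply: (connect_trans xu); rewrite sym; apply: (connect_trans yv).
  have /connectP[s + ->] := e_connected v u.
  elim: s v {yv} => [|w s IH] v /=; first by rewrite connect0.
  move=> /andP[vw ws]; apply: connect_trans (IH _ ws); apply: connect1.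
  have [d <- <-] := dart_edge vw.
  by apply: (@mtri_mem _ _ (cD d)); rewrite /= !eqxx.
have dv d : connect (fun x y => y \in link x) (cD d) (cV (tl d)).
  by apply: connect1; rewrite /= inE eqxx.
case: a => [v|[d|f]].
- by exists v; exact: connect0.
- by exists (tl d); exact: dv.
- exists (tl (val f)); apply: connect_trans (dv _); apply: connect1.
  by rewrite /= map_f // mem_orbit_face face_of_val.
Qed.


Variable R : realType.
Variable v0 : V.
Let C : set {ptws cell -> R} := @cplx R cell link.
Let S : topologicalType := set_type C.

Lemma on_tri_sum (p : cell -> R) x y z : tri link x y z -> on_tri p x y z ->
  p = fun w => (w == x)%:R * p x + (w == y)%:R * p y + (w == z)%:R * p z.
Proof.
move=> t s; apply/funext => w.
have xy := tri_neq12 link_uniq link_size link_rot t.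
have yz := tri_neq23 link_uniq link_size t.
have xz := tri_neq13 link_uniq link_size link_rot t.
have [->|wx] := eqVneq w x; first by rewrite (negbTE xy) (negbTE xz) /=; ring.
have [->|wy] := eqVneq w y; first by rewrite (negbTE yz) /=; ring.
have [->|wz] := eqVneq w z; first by rewrite /=; ring.
by rewrite s ?inE ?negb_or ?wx ?wy ?wz //=; ring.
Qed.

(** * The embedded graph and the open faces *)

Definition crd (p : S) (x : cell) : R := (set_val p : cell -> R) x.

Lemma crd_ge0 p x : 0 <= crd p x.
Proof. by have [p0 _ _] := cplxP p; exact: p0. Qed.

Lemma crd_support p x : 0 < crd p x ->
  exists y z, mtri x y z /\ on_tri (crd p) x y z.
Proof.
move=> px; have [y [z [t s]]] := star_support link_rot (cplxP p) px.
by exists y, z; split => //; exact/mtriP.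
Qed.

Lemma crd_sum p x y z : mtri x y z -> on_tri (crd p) x y z ->
  crd p x + crd p y + crd p z = 1.
Proof.
move=> /mtriP t s; have [_ <- _] := cplxP p.
by rewrite (sum_on_tri link_uniq link_size link_rot t s).
Qed.

Definition dual_cell (x : cell) : bool := if x is inr _ then true else false.

Definition inner (f : face_type) (x : cell) : bool :=
  match x with
  | inl _ => false
  | inr (inl d) => face_of d == f
  | inr (inr g) => g == f
  end.

Lemma mtri_inner f x y z : mtri x y z -> inner f x -> dual_cell y -> inner f y.
Proof.
case: x => [u|[d|g]]; case: y => [v|[d'|g']]; case: z => [w|[d''|h]] //=
  /andP[/eqP h1 /eqP h2] /eqP <-; subst; rewrite ?face_of_fnx //.
Qed.

Lemma mtri_inner3 f x y z : mtri x y z -> inner f x -> dual_cell z -> inner f z.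
Proof.
case: x => [u|[d|g]]; case: y => [v|[d'|g']]; case: z => [w|[d''|h]] //=
  /andP[/eqP h1 /eqP h2] /eqP <-; subst; rewrite ?face_of_fnx //.
Qed.

Lemma inner_dual f x : inner f x -> dual_cell x.
Proof. by case: x. Qed.

Lemma dual_inner x : dual_cell x -> exists f, inner f x.
Proof. by case: x => [//|[d|f]] _; [exists (face_of d)|exists f] => /=. Qed.

Lemma inner_uniq f g x : inner f x -> inner g x -> f = g.
Proof. by case: x => [//|[d|h]] /= /eqP <- /eqP. Qed.

(** All the corners of one triangle that are not graph vertices belong to the same face. *)
Lemma support_inner f p x y : inner f x -> 0 < crd p x -> 0 < crd p y ->
  dual_cell y -> inner f y.
Proof.
move=> fx px py dy; have [a [b [t s]]] := crd_support px.
have : y \in [:: x; a; b] by apply: contraTT py => /s ->; rewrite ltxx.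
rewrite !inE => /or3P[] /eqP yE; subst y => //.
  exact: mtri_inner t fx dy.
exact: mtri_inner3 t fx dy.
Qed.

(** A union of open stars, hence open. Each point of the complement of the graph lies in exactly one
    of these sets. *)
Definition face_set f : set S := [set p | exists2 x, inner f x & 0 < crd p x].

Lemma face_set_open f : open (face_set f).
Proof.
have -> : face_set f = \bigcup_(x in [set x | inner f x]) star x.
  by rewrite eqEsubset; split => p [x fx px]; exists x.
by apply: bigcup_open => x _; exact: star_open.
Qed.

Lemma face_set_inj f g p : face_set f p -> face_set g p -> f = g.
Proof.
move=> [x fx px] [y gy py].
exact: (inner_uniq (support_inner fx px py (inner_dual gy)) gy).
Qed.

Definition ext (r : V -> R) : {ptws cell -> R} :=
  fun x => if x is inl v then r v else 0.

Lemma ext_continuous : continuous (ext : {ptws V -> R} -> {ptws cell -> R}).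
Proof.
apply: continuous_ptws => -[v|x] /=; first exact: ptws_eval_continuous.
exact: cst_continuous.
Qed.

Lemma e_sym u v : e u v -> e v u.
Proof.
move=> /dart_edge[d <- <-]; have := edge_dart (rev d).
by rewrite hd_rev.
Qed.

Lemma sum_ext (r : V -> R) : \sum_x ext r x = \sum_v r v.
Proof. by rewrite big_sumType /= [X in _ + X]big1 ?addr0. Qed.


Lemma ext_cplx r : realization e r -> C (ext r).
Proof.
move=> [u [v [t [uv t01 ->]]]].
move: t01; rewrite in_unit => /andP[t0 t1].
split.
- by case=> [w|x] //=; rewrite /edge_point addr_ge0 // mulr_ge0 //; lra.
- by rewrite sum_ext /edge_point big_split /= -!mulr_sumr !sum_delta; ring.
- have [d [du dv]] : exists d, tl d = u /\ (v = u \/ v = hd d).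
    case/orP: uv => [/eqP <-|/dart_edge[d <- <-]]; last by exists d; auto.
    by exists (out u); rewrite tl_out; auto.
  exists (cV u), (cV (hd d)), (cD d); split.
    by apply/mtriP; rewrite /= du !eqxx.
  move=> [w|x] //=; rewrite !inE !negb_or /edge_point => /and3P[h1 h2 _].
  have wu : w == u = false by apply: contraNF h1 => /eqP ->.
  have wh : w == hd d = false by apply: contraNF h2 => /eqP ->.
  by rewrite wu; case: dv => ->; rewrite ?wu ?wh /=; ring.
Qed.

Definition emb (r : {ptws V -> R}) : S :=
  to_cplx (ext r) (cplx_vertex R link_size (cV v0)).

Lemma set_val_emb r : realization e r -> set_val (emb r) = ext r.
Proof. by move=> /ext_cplx rr; rewrite /emb to_cplxE. Qed.

Lemma crd_emb r x : realization e r -> crd (emb r) x = ext r x.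
Proof. by move=> rr; rewrite /crd set_val_emb. Qed.

Lemma emb_embedding : embedding e emb.
Proof.
split.
  apply: (@to_set_type_within {ptws cell -> R} C {ptws V -> R} (realization e)
    emb ext); first by move=> r; exact: set_val_emb.
  by apply: continuous_subspaceT; exact: ext_continuous.
move=> x y rx ry xy; apply/funext => v.
by have := crd_emb (cV v) rx; rewrite xy (crd_emb _ ry).
Qed.

Lemma primal_edge (p : S) u v t : (u == v) || e u v -> t \in `[0, 1] ->
  (forall x, dual_cell x -> crd p x = 0) ->
  (forall w, crd p (cV w) = edge_point u v t w) ->
  exists2 r, realization e r & emb r = p.
Proof.
move=> uv t01 p0 pE; have rr : realization e (edge_point u v t) by exists u, v, t.
exists (edge_point u v t) => //; apply: val_inj.
rewrite -[LHS]/(set_val _) set_val_emb //; apply/funext => -[w|x].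
  by rewrite /= -pE.
by rewrite /= -(p0 (inr x)).
Qed.

(** No triangle has three graph vertices as corners, and two of them in one triangle are the ends of
    a dart; such a point is therefore on an edge or at a vertex. *)
Lemma primal_support (p : S) : (forall x, dual_cell x -> crd p x = 0) ->
  exists2 r, realization e r & emb r = p.
Proof.
move=> p0; have [[u|x] px] := star_cover p; last first.
  by move: px; rewrite /star /= -/(crd _ _) p0 // ltxx.
have edge v z : dual_cell z -> (u == v) || e u v -> crd p (cV u) + crd p (cV v) = 1 ->
    u != v -> (forall w, w != u -> w != v -> crd p (cV w) = 0) ->
    exists2 r, realization e r & emb r = p.
  move=> dz uv s1 nuv s0; apply: (primal_edge (t := crd p (cV v)) uv _ p0).
    by rewrite in_unit; have := crd_ge0 p (cV u); have := crd_ge0 p (cV v); lra.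
  move=> w; rewrite /edge_point.
  have [->|wu] := eqVneq w u; first by rewrite (negbTE nuv) /=; lra.
  have [->|wv] := eqVneq w v; first by rewrite /=; lra.
  by rewrite s0 // /=; lra.
have [y [z [t s]]] := crd_support px; have s1 := crd_sum t s.
case: y t s s1 => [v|[d|f]]; case: z => [w|[d'|f']] //= /andP[/eqP h1 /eqP h2] s s1.
- apply: (edge v (cD d')) => //.
  + by rewrite -h1 -h2 edge_dart orbT.
  + by rewrite -s1 (p0 (inr (inl d'))) // addr0.
  + by rewrite -h1 -h2 tl_neq_hd.
  + by move=> w wu wv; apply: s; rewrite !inE !negb_or /=; apply/and3P; split.
- apply: (edge w (cD d)) => //.
  + by rewrite e_sym ?orbT // -h1 -h2 edge_dart.
  + by rewrite -s1 (p0 (inr (inl d))) // addr0.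
  + by rewrite -h1 -h2 eq_sym tl_neq_hd.
  + by move=> w' wu wv; apply: s; rewrite !inE !negb_or /=; apply/andP; split.
- apply: (primal_edge (u := u) (v := u) (t := 0) _ _ p0); rewrite ?eqxx ?in_unit ?lexx ?ler01 //.
  move=> w; rewrite /edge_point; have [->|wu] := eqVneq w u.
    by move: s1; rewrite (p0 (inr (inl d))) // (p0 (inr (inl d'))) //=; lra.
  by rewrite s /= ?mulr0 ?addr0 // !inE !negb_or; apply/and3P; split.
Qed.

Lemma compl_emb (p : S) : (~` (emb @` realization e)) p <-> exists f, face_set f p.
Proof.
split=> [np|[f [x fx px]] [r rr rp]]; last first.
  move: px; rewrite -rp crd_emb //; case: x fx => //= ? _; by rewrite ltxx.
apply: contrapT => nf; apply: np.
have [|r rr rp] := @primal_support p; last by exists r.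
move=> x dx; apply/eqP; rewrite eq_le crd_ge0 andbT leNgt; apply/negP => px.
by have [f fx] := dual_inner dx; apply: nf; exists f, x.
Qed.

(** * Polar coordinates on a sector of a face *)

Definition lam (r : R) : R := Num.max 0 (2 * r - 1).
Definition kap (r : R) : R := Num.min 1 (2 * r).
(** The barycentric coefficients of the centre [o], of [u], [v], and of the dart points [d], [d'].
    Writing them with [max] and [min] makes continuity immediate; [coef_spec] lists the three
    pieces. *)
Definition cO (q : plane R) : R := 1 - kap q.1.
Definition cU (q : plane R) : R := Num.max 0 (lam q.1 - q.2).
Definition cW (q : plane R) : R := Num.min (lam q.1) q.2.
Definition cA (q : plane R) : R := kap q.1 * (1 - Num.max (lam q.1) q.2).
Definition cB (q : plane R) : R := kap q.1 * Num.max 0 (q.2 - lam q.1).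

Definition square : set (plane R) :=
  [set q | 0 <= q.1 <= 1 /\ 0 <= q.2 <= 1].

Variant coef_spec (q : plane R) : Prop :=
  | CoefCentre of q.1 <= 1 / 2 & cO q = 1 - 2 * q.1 & cU q = 0 & cW q = 0
      & cA q = 2 * q.1 * (1 - q.2) & cB q = 2 * q.1 * q.2
  | CoefOuter of 1 / 2 <= q.1 & q.2 <= 2 * q.1 - 1 & cO q = 0
      & cU q = 2 * q.1 - 1 - q.2 & cW q = q.2 & cA q = 2 - 2 * q.1 & cB q = 0
  | CoefInner of 1 / 2 <= q.1 & 2 * q.1 - 1 <= q.2 & cO q = 0
      & cU q = 0 & cW q = 2 * q.1 - 1 & cA q = 1 - q.2 & cB q = q.2 - (2 * q.1 - 1).

Lemma coef_centre (r t : R) : 0 <= r <= 1 / 2 -> 0 <= t ->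
  [/\ cO (r, t) = 1 - 2 * r, cU (r, t) = 0, cW (r, t) = 0,
      cA (r, t) = 2 * r * (1 - t) & cB (r, t) = 2 * r * t].
Proof.
move=> /andP[r0 rh] t0.
have l0 : lam r = 0 by apply: max_l; lra.
have k0 : kap r = 2 * r by apply: min_r; lra.
by split; rewrite /cO /cU /cW /cA /cB /= ?l0 ?k0 ?sub0r ?subr0
   ?(max_r t0) ?(min_l t0) //; apply: max_l; lra.
Qed.

Lemma coef_outer (r t : R) : 1 / 2 <= r -> t <= 2 * r - 1 ->
  [/\ cO (r, t) = 0, cU (r, t) = 2 * r - 1 - t, cW (r, t) = t,
      cA (r, t) = 2 - 2 * r & cB (r, t) = 0].
Proof.
move=> rh th.
have l0 : lam r = 2 * r - 1 by apply: max_r; lra.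
have k0 : kap r = 1 by apply: min_l; lra.
split; rewrite /cO /cU /cW /cA /cB /= ?l0 ?k0 //.
- lra.
- by apply: max_r; lra.
- by apply: min_r.
- by rewrite max_l //; lra.
- by rewrite max_l ?mulr0 //; lra.
Qed.

Lemma coef_inner (r t : R) : 1 / 2 <= r -> 2 * r - 1 <= t ->
  [/\ cO (r, t) = 0, cU (r, t) = 0, cW (r, t) = 2 * r - 1,
      cA (r, t) = 1 - t & cB (r, t) = t - (2 * r - 1)].
Proof.
move=> rh th.
have l0 : lam r = 2 * r - 1 by apply: max_r; lra.
have k0 : kap r = 1 by apply: min_l; lra.
split; rewrite /cO /cU /cW /cA /cB /= ?l0 ?k0 //.
- lra.
- by apply: max_l; lra.
- by apply: min_l; lra.
- by rewrite max_r ?mul1r //; lra.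
- by rewrite max_r ?mul1r //; lra.
Qed.

Lemma coefP q : square q -> coef_spec q.
Proof.
case: q => r t [/= /andP[r0 r1] /andP[t0 t1]].
have [rh|rh] := leP r (1 / 2).
  by have [|] := @coef_centre r t _ t0; [rewrite r0|exact: CoefCentre].
have [th|th] := leP t (2 * r - 1).
  by have [] := coef_outer (ltW rh) th; apply: CoefOuter => //; exact: ltW.
by have [] := coef_inner (ltW rh) (ltW th); apply: CoefInner => //; exact: ltW.
Qed.

Lemma coef_ge0 q : square q ->
  [/\ 0 <= cO q, 0 <= cU q, 0 <= cW q, 0 <= cA q & 0 <= cB q].
Proof.
move=> sq; have [/andP[r0 r1] /andP[t0 t1]] := sq.
by case: (coefP sq) => [h -> -> -> -> ->|h h' -> -> -> -> ->|h h' -> -> -> -> ->];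
  split; rewrite ?mulr_ge0 //; lra.
Qed.

Lemma coef_sum q : square q -> cO q + cU q + cW q + cA q + cB q = 1.
Proof.
move=> sq; case: (coefP sq) => [h -> -> -> -> ->|h h' -> -> -> -> ->|h h' -> -> -> -> ->];
  ring.
Qed.

(* The triangles [(o, d, d')], [(u, v, d)] and [(d, v, d')] of a dart
   [d : u -> v] form a sector of its face.  In the polar coordinates [(r, t)] of
   this sector, [r <= 1 / 2] is the first triangle, and the circle of radius
   [r >= 1 / 2] first crosses the second triangle, parallel to [u v], for
   [t <= 2 r - 1], then the third one, parallel to [d d']. *)
Definition wedge (d : D) (q : plane R) : {ptws cell -> R} := fun w =>
  (w == cF (face_of d))%:R * cO q + (w == cV (tl d))%:R * cU q +
  (w == cV (hd d))%:R * cW q + (w == cD d)%:R * cA q + (w == cD (fnx d))%:R * cB q.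

Lemma wedgeF d q f : wedge d q (cF f) = (f == face_of d)%:R * cO q.
Proof. rewrite /wedge /=; ring. Qed.
Lemma wedgeV d q v :
  wedge d q (cV v) = (v == tl d)%:R * cU q + (v == hd d)%:R * cW q.
Proof. rewrite /wedge /=; ring. Qed.
Lemma wedgeD d q d' :
  wedge d q (cD d') = (d' == d)%:R * cA q + (d' == fnx d)%:R * cB q.
Proof. rewrite /wedge /=; ring. Qed.


Lemma wedge_cplx d q : square q -> C (wedge d q).
Proof.
move=> sq; have [hO hU hW hA hB] := coef_ge0 sq; split.
- move=> w; rewrite /wedge; do 4 (apply: addr_ge0; last by rewrite mulr_ge0 ?ler0n).
  by rewrite mulr_ge0 ?ler0n.
- by rewrite /wedge !big_split /= -!mulr_suml !sum_delta !mul1r coef_sum.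
case: (coefP sq) => [h _ u w _ _|h h' o _ _ _ b|h h' o u _ _ _].
- exists (cF (face_of d)), (cD d), (cD (fnx d)); split.
    by apply/mtriP; rewrite /= !eqxx.
  move=> x; rewrite !inE !negb_or /wedge => /and3P[/negbTE -> /negbTE -> /negbTE ->].
  by rewrite u w /=; ring.
- exists (cV (tl d)), (cV (hd d)), (cD d); split.
    by apply/mtriP; rewrite /= !eqxx.
  move=> x; rewrite !inE !negb_or /wedge => /and3P[/negbTE -> /negbTE -> /negbTE ->].
  by rewrite o b /=; ring.
- exists (cD d), (cV (hd d)), (cD (fnx d)); split.
    by apply/mtriP; rewrite /= !eqxx.
  move=> x; rewrite !inE !negb_or /wedge => /and3P[/negbTE -> /negbTE -> /negbTE ->].
  by rewrite o u /=; ring.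
Qed.

(** The ray [t = 1] runs from [o] through [d'] to [v], which are the centre, the dart point and the
    tail of the next sector. *)
Lemma wedge_next d r : 0 <= r <= 1 -> wedge d (r, 1) = wedge (fnx d) (r, 0).
Proof.
move=> r01; have s1 : square (r, 1) by split=> //=; lra.
have s0 : square (r, 0) by split=> //=; lra.
suff [e1 e2 e3 e4 e5] : [/\ cO (r, 1) = cO (r, 0), cU (r, 1) = cW (r, 0),
    cW (r, 1) = cU (r, 0), cA (r, 1) = cB (r, 0) & cB (r, 1) = cA (r, 0)].
  apply/funext => w; rewrite /wedge face_of_fnx tl_fnx e1 e2 e3 e4 e5.
  have z : cB (r, 0) = 0 /\ cW (r, 0) = 0.
    by case: (coefP s0) => /= [h _ _ -> _ ->|h h' _ _ -> _ ->|h h' _ _ -> _ ->];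
      split; lra.
  by rewrite !z.1 !z.2; ring.
case: (coefP s1) => /= [h1 -> -> -> -> ->|h1 h1' -> -> -> -> ->|h1 h1' -> -> -> -> ->];
case: (coefP s0) => /= [h -> -> -> -> ->|h h' -> -> -> -> ->|h h' -> -> -> -> ->];
  split; lra.
Qed.

Lemma wedge_centre d d' t t' : 0 <= t <= 1 -> 0 <= t' <= 1 ->
  face_of d = face_of d' -> wedge d (0, t) = wedge d' (0, t').
Proof.
move=> t01 t01' dd.
have z s : 0 <= s <= 1 -> [/\ cO (0, s) = 1, cU (0, s) = 0, cW (0, s) = 0,
    cA (0, s) = 0 & cB (0, s) = 0].
  move=> s01; have sq : square (0, s) by split => //=; lra.
  by case: (coefP sq) => /= [h -> -> -> -> ->|h h' -> -> -> -> ->|h h' -> -> -> -> ->];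
    split; lra.
apply/funext => w; rewrite /wedge dd.
by have [-> -> -> -> ->] := z _ t01; have [-> -> -> -> ->] := z _ t01'; rewrite !mulr0.
Qed.

(** The radius is read off [cO] and [cU + cW]. For [0 < r < 1] and [t < 1] the coefficient [cA] is
    positive, so two different darts would each have to follow the other, giving a face of length
    two. With the same dart, [cB] and [cU] give [t]. The circle [r = 1] is excluded because a face
    may pass through a vertex several times. *)
Lemma wedge_inj d d' q q' : square q -> square q' -> q.2 < 1 -> q'.2 < 1 ->
  q.1 < 1 -> face_of d = face_of d' -> wedge d q = wedge d' q' ->
  q.1 = q'.1 /\ (0 < q.1 -> d = d' /\ q.2 = q'.2).
Proof.
move=> sq sq' t1 t1' r1 dd E.
have EE w : wedge d q w = wedge d' q' w by rewrite E.
have eO : cO q = cO q'.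
  by have := EE (cF (face_of d)); rewrite !wedgeF dd eqxx !mul1r.
have eL : cU q + cW q = cU q' + cW q'.
  have sumV d1 q1 : \sum_v wedge d1 q1 (cV v) = cU q1 + cW q1.
    under eq_bigr do rewrite wedgeV.
    by rewrite big_split /= -!mulr_suml !sum_delta !mul1r.
  by rewrite -(sumV d) -(sumV d'); apply: eq_bigr => v _; rewrite EE.
have [/andP[r0 _] /andP[t0 _]] := sq; have [/andP[r0' _] /andP[t0' _]] := sq'.
have rr : q.1 = q'.1.
  move: eO eL.
  case: (coefP sq) => [h -> -> -> _ _|h h' -> -> -> _ _|h h' -> -> -> _ _];
  case: (coefP sq') => [k -> -> -> _ _|k k' -> -> -> _ _|k k' -> -> -> _ _]; lra.
split => // rp.
have rp' : 0 < q'.1 by rewrite -rr.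
have Apos : 0 < cA q.
  by case: (coefP sq) => [h _ _ _ -> _|h h' _ _ _ -> _|h h' _ _ _ -> _];
    rewrite ?mulr_gt0 //; lra.
have Apos' : 0 < cA q'.
  by case: (coefP sq') => [h _ _ _ -> _|h h' _ _ _ -> _|h h' _ _ _ -> _];
    rewrite ?mulr_gt0 //; lra.
have fn c : (c == fnx c) = false.
  by apply/eqP => h; have := tl_neq_hd c; rewrite -tl_fnx -h eqxx.
have ddE : d = d'.
  apply/eqP/negP => /negP nd.
  have h1 : d = fnx d'.
    have := EE (cD d); rewrite !wedgeD eqxx fn (negbTE nd).
    case: eqP => [//|_] /= h; exfalso; lra.
  have h2 : d' = fnx d.
    have := EE (cD d'); rewrite !wedgeD eqxx fn eq_sym (negbTE nd).
    case: eqP => [//|_] /= h; exfalso; lra.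
  by have := fnx2_neq d'; rewrite -h1 -h2 eqxx.
split=> //; subst d'.
have eB : cB q = cB q'.
  by have := EE (cD (fnx d)); rewrite !wedgeD eqxx eq_sym fn /=; lra.
have eU : cU q = cU q'.
  by have := EE (cV (tl d)); rewrite !wedgeV eqxx (negbTE (tl_neq_hd d)) /=; lra.
move: eB eU.
case: (coefP sq) => [h _ -> _ _ ->|h h' _ -> _ _ ->|h h' _ -> _ _ ->];
case: (coefP sq') => [k _ -> _ _ ->|k k' _ -> _ _ ->|k k' _ -> _ _ ->];
  rewrite -?rr => eB eU; try lra.
- have r2 : 2 * q.1 != 0 by lra.
  by move: eB => /(mulfI r2).
- have rh : q.1 = 1 / 2 by lra.
  by move: eB; rewrite rh; lra.
- have rh : q.1 = 1 / 2 by lra.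
  by move: eB; rewrite rh; lra.
- have rh : q.1 = 1 / 2 by lra.
  by move: eB; rewrite rh; lra.
- have rh : q.1 = 1 / 2 by lra.
  by move: eB; rewrite rh; lra.
Qed.

Lemma wedge_continuous d : continuous (wedge d).
Proof.
have c1 : continuous (fun q : plane R => q.1) by move=> q; exact: cvg_fst.
have c2 : continuous (fun q : plane R => q.2) by move=> q; exact: cvg_snd.
have c0 (c : R) : continuous (fun q : plane R => c) by exact: cst_continuous.
have cl : continuous (fun q : plane R => lam q.1).
  apply: (@max_fun_continuous _ _ R (fun q : plane R => 0) (fun q => 2 * q.1 - 1)).
    exact: c0.
  by move=> q; apply: cvgB; [apply: cvgM; [exact: c0|exact: c1]|exact: c0].
have ck : continuous (fun q : plane R => kap q.1).
  apply: (@min_fun_continuous _ _ R (fun q : plane R => 1) (fun q => 2 * q.1)).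
    exact: c0.
  by move=> q; apply: cvgM; [exact: c0|exact: c1].
have cO' : continuous cO by move=> q; apply: cvgB; [exact: c0|exact: ck].
have cU' : continuous cU.
  apply: (@max_fun_continuous _ _ R (fun q : plane R => 0) (fun q => lam q.1 - q.2)).
    exact: c0.
  by move=> q; apply: cvgB; [exact: cl|exact: c2].
have cW' : continuous cW.
  by apply: (@min_fun_continuous _ _ R (fun q : plane R => lam q.1) (fun q => q.2)).
have cA' : continuous cA.
  move=> q; apply: cvgM; first exact: ck.
  apply: cvgB; first exact: c0.
  exact: (@max_fun_continuous _ _ R (fun q : plane R => lam q.1) (fun q => q.2) cl c2 q).
have cB' : continuous cB.
  move=> q; apply: cvgM; first exact: ck.
  apply: (@max_fun_continuous _ _ R (fun q : plane R => 0) (fun q => q.2 - lam q.1)).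
    exact: c0.
  by move=> q'; apply: cvgB; [exact: c2|exact: cl].
apply: continuous_ptws => w q.
do 4 (apply: cvgD; last by apply: cvgM; [exact: c0 |
  by [exact: cB' | exact: cA' | exact: cW' | exact: cU']]).
by apply: cvgM; [exact: c0|exact: cO'].
Qed.

(** * The closed disc of a face *)

Definition flen (f : face_type) := order fnx (val f).
Definition dart (f : face_type) (i : nat) := iter i fnx (val f).

Lemma flen_gt3 f : (3 < flen f)%N. Proof. exact: face_size. Qed.
Lemma face_of_dart f i : face_of (dart f i) = f.
Proof. by elim: i => [|i IH]; rewrite /dart ?face_of_val //= face_of_fnx. Qed.
Lemma dart_flen f : dart f (flen f) = dart f 0.
Proof. exact: iter_order. Qed.
Lemma dart_mod f i : (i < flen f)%N -> dart f (i.+1 %% flen f) = fnx (dart f i).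
Proof.
move=> im; case: (ltnP i.+1 (flen f)) => h; first by rewrite modn_small.
have e1 : i.+1 = flen f by lia.
by rewrite e1 modnn -dart_flen -e1.
Qed.
Lemma dart_index f i j : (i < flen f)%N -> (j < flen f)%N ->
  dart f i = dart f j -> i = j.
Proof. by move=> im jm h; rewrite -(findex_iter im) -(findex_iter jm) -/(dart f i) h. Qed.
Lemma dart_surj d : exists2 i, (i < flen (face_of d))%N & dart (face_of d) i = d.
Proof.
have c : fconnect fnx (val (face_of d)) d.
  by rewrite -face_of_eq face_of_val.
by exists (findex fnx (val (face_of d)) d); [exact: findex_max|exact: iter_findex].
Qed.

(** The side [r = 1], which is mapped into the graph, is left out; under [pie] this set gives the
    open disc. *)
Definition half_square : set (plane R) := [set q | square q /\ q.1 < 1].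

Lemma square_compact : compact square.
Proof.
have -> : square = `[0, 1]%classic `*` `[0, 1]%classic.
  by rewrite eqEsubset; split=> q []; rewrite /= !in_itv.
by apply: compact_setX; exact: segment_compact.
Qed.

Lemma closed_discP (m : nat) q : (0 < m)%N -> @closed_disc R q ->
  exists i k, [/\ (i < m)%N, square k, pie m i k = q & k.1 ^+ 2 = q.1 ^+ 2 + q.2 ^+ 2].
Proof.
case: q => x y m0 xy; have [i [r [t [im r0 t01 rE pE]]]] := pie_surj x y m0.
exists i, (r, t); split => //; split => //=; rewrite r0 /=.
rewrite -(ler_pXn2r (ltn0Sn 1)) ?nnegrE //.
by move: xy; rewrite /closed_disc /= -rE expr1n.
Qed.

Lemma pie_norm (m i : nat) (k : plane R) :
  (pie m i k).1 ^+ 2 + (pie m i k).2 ^+ 2 = k.1 ^+ 2.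
Proof.
rewrite /pie /=; set a := 2 * pi * (i%:R + k.2) / m%:R.
by rewrite -[RHS]mulr1 -(cos2Dsin2 a); ring.
Qed.

Definition wpt (d : D) (k : plane R) : S :=
  to_cplx (wedge d k) (cplx_vertex R link_size (cV v0)).

Lemma crd_wpt d k x : square k -> crd (wpt d k) x = wedge d k x.
Proof. by move=> /(wedge_cplx d) h; rewrite /crd /wpt to_cplxE. Qed.

Lemma wpt_eq d k (p : S) : square k -> (forall x, crd p x = wedge d k x) ->
  wpt d k = p.
Proof.
move=> sk h; apply: val_inj; rewrite -[LHS]/(set_val _).
by apply/funext => x; rewrite -[RHS]/(crd p x) h -crd_wpt.
Qed.

Lemma wpt_continuous d : {within square, continuous (wpt d)}.
Proof.
apply: (@to_set_type_within {ptws cell -> R} C (plane R) square (wpt d) (wedge d)).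
  by move=> k /(wedge_cplx d) h; rewrite /wpt to_cplxE.
by apply: continuous_subspaceT; exact: wedge_continuous.
Qed.

(** A point on the ray [t = 1] is moved to [t = 0] in the next sector, simultaneously in the disc
    and in the complex. Injectivity of both parametrizations needs [t < 1]. *)
Lemma wpt_normal f i k : (i < flen f)%N -> square k -> exists j k',
  [/\ (j < flen f)%N, square k', k'.2 < 1, k'.1 = k.1 &
      wpt (dart f i) k = wpt (dart f j) k' /\ pie (flen f) i k = pie (flen f) j k'].
Proof.
case: k => r t im sk; have [t1|t1] := ltP t 1.
  by exists i, (r, t); split.
have tE : t = 1 by apply/eqP; rewrite eq_le t1 andbT; case: sk => _ /andP[].
subst t; exists (i.+1 %% flen f)%N, (r, 0).
have fl : (0 < flen f)%N by apply: leq_trans (flen_gt3 f).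
split=> //.
- by rewrite ltn_mod.
- by case: sk => /= h _; split => //=; lra.
- split; last exact: pie_next.
  by rewrite /wpt dart_mod // wedge_next //; case: sk.
Qed.

(** Together with [wpt_inj] this says that, inside the open disc, [pie] and [wpt] identify the same
    points; each lemma feeds one use of [factor_through_compact]. *)
Lemma wpt_pie_eq f i j k k' : (i < flen f)%N -> (j < flen f)%N ->
  square k -> square k' -> pie (flen f) i k = pie (flen f) j k' ->
  wpt (dart f i) k = wpt (dart f j) k'.
Proof.
move=> im jm sk sk'.
have [i1 [[r1 t1] [im1 sk1 /= h1 h1' [-> ->]]]] := wpt_normal im sk.
have [j1 [[r2 t2] [jm1 sk2 /= h2 h2' [-> ->]]]] := wpt_normal jm sk'.
have [/= /andP[r10 r11] /andP[t10 _]] := sk1.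
have [/= /andP[r20 r21] /andP[t20 _]] := sk2.
move=> /pie_inj [] //; try (by apply/andP).
move=> rr; subst r2; have [z|r1n] := eqVneq r1 0.
  move=> _; rewrite /wpt -rr z (@wedge_centre _ (dart f j1) _ t2) ?face_of_dart //.
    by rewrite t10 ltW.
  by rewrite t20 ltW.
rewrite -rr => h; have [|-> ->] // := h.
by rewrite lt_neqAle eq_sym r1n.
Qed.

Lemma wpt_inj f i j k k' : (i < flen f)%N -> (j < flen f)%N ->
  half_square k -> square k' -> wpt (dart f i) k = wpt (dart f j) k' ->
  half_square k' /\ pie (flen f) i k = pie (flen f) j k'.
Proof.
move=> im jm [sk k1] sk'.
have [i1 [k2 [im1 sk1 h1 h1' [-> ->]]]] := wpt_normal im sk.
have [j1 [k3 [jm1 sk2 h2 h2' [-> ->]]]] := wpt_normal jm sk'.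
move=> E; have : wedge (dart f i1) k2 = wedge (dart f j1) k3.
  by apply/funext => x; rewrite -!crd_wpt // E.
rewrite -h1' in k1.
move=> /(wedge_inj sk1 sk2 h1 h2 k1) []; first by rewrite !face_of_dart.
move=> rr; split; first by split => //; rewrite -h2' -rr.
have [r0|rn] := eqVneq k2.1 0.
  by rewrite /pie -rr r0 !mul0r.
have [|/(dart_index im1 jm1) -> tt] := b.
  by case: sk1 => /andP[h _] _; rewrite lt_neqAle eq_sym rn.
by rewrite /pie -rr tt.
Qed.

Lemma wpt_half f i k : half_square k -> face_set f (wpt (dart f i) k).
Proof.
move=> [sk k1]; have [/andP[r0 _] /andP[t0 t1]] := sk.
have [hO hU hW hA hB] := coef_ge0 sk.
have [Op|] := ltP 0 (cO k).
  exists (cF f); first by rewrite /= eqxx.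
  by rewrite crd_wpt // wedgeF face_of_dart eqxx mul1r.
have [Ap|] := ltP 0 (cA k).
  move=> _; exists (cD (dart f i)); first by rewrite /= face_of_dart.
  rewrite crd_wpt // wedgeD eqxx mul1r ltr_wpDr //.
  by rewrite mulr_ge0.
have [Bp|] := ltP 0 (cB k).
  move=> _ _; exists (cD (fnx (dart f i))); first by rewrite /= face_of_fnx face_of_dart.
  by rewrite crd_wpt // wedgeD eqxx mul1r ltr_wpDl // mulr_ge0.
by case: (coefP sk) => [h -> _ _ -> ->|h h' -> _ _ -> ->|h h' -> _ _ -> ->]; lra.
Qed.

Lemma wedge_centre_surj (p : S) d :
  on_tri (crd p) (cF (face_of d)) (cD d) (cD (fnx d)) ->
  exists2 k, half_square k & forall y, crd p y = wedge d k y.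
Proof.
move=> s; have t : mtri (cF (face_of d)) (cD d) (cD (fnx d)) by rewrite /= !eqxx.
have s1 := crd_sum t s; have pE := on_tri_sum ((mtriP _ _ _).2 t) s.
have p0 := crd_ge0 p.
set a := crd p (cF (face_of d)) in s1 pE *; set b := crd p (cD d) in s1 pE *.
set c := crd p (cD (fnx d)) in s1 pE *.
have [a0 b0 c0] : [/\ 0 <= a, 0 <= b & 0 <= c] by split; exact: p0.
(* Solves [2 * r = b + c] and [2 * r * t = c]. At the centre the quotient [c / (b + c)] is 0, where
   any angle would do. *)
have bcE : (b + c) * (c / (b + c)) = c.
  have [bc|n] := eqVneq (b + c) 0; last by rewrite mulrC divfK.
  by rewrite bc mul0r; lra.
have t01 : 0 <= c / (b + c) <= 1.
  rewrite divr_ge0 ?addr_ge0 //=; have [->|n] := eqVneq (b + c) 0.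
    by rewrite invr0 mulr0.
  by rewrite ler_pdivrMr ?mul1r; lra.
exists ((b + c) / 2, c / (b + c)); first by split=> /=; [split=> //=; lra|lra].
have [||o u w A B] := @coef_centre ((b + c) / 2) (c / (b + c)).
- lra.
- by case/andP: t01.
move=> y; rewrite pE // /wedge o u w A B.
have h2 : 2 * ((b + c) / 2) = b + c by field.
have aE : a = 1 - (b + c) by lra.
by rewrite h2 (mulrBr (b + c)) mulr1 bcE aE; ring.
Qed.

Lemma wedge_outer_surj (p : S) d :
  on_tri (crd p) (cV (tl d)) (cV (hd d)) (cD d) -> 0 < crd p (cD d) ->
  exists2 k, half_square k & forall y, crd p y = wedge d k y.
Proof.
move=> s pos; have t : mtri (cV (tl d)) (cV (hd d)) (cD d) by rewrite /= !eqxx.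
have s1 := crd_sum t s; have pE := on_tri_sum ((mtriP _ _ _).2 t) s.
have p0 := crd_ge0 p.
set a := crd p (cV (tl d)) in s1 pE *; set b := crd p (cV (hd d)) in s1 pE *.
set c := crd p (cD d) in s1 pE pos *.
have [a0 b0] : 0 <= a /\ 0 <= b by split; exact: p0.
(* From [cU + cW = 2 * r - 1 = a + b] and [cW = t = b]. *)
exists ((1 + a + b) / 2, b).
  by split; first split; rewrite /=; lra.
have [||o u w A B] := @coef_outer ((1 + a + b) / 2) b; [lra|lra|].
move=> y; rewrite pE // /wedge o u w A B.
rewrite (_ : 2 * _ - 1 - b = a); last by field.
rewrite (_ : 2 - _ = c); last lra.
ring.
Qed.

Lemma wedge_inner_surj (p : S) d :
  on_tri (crd p) (cD d) (cV (hd d)) (cD (fnx d)) ->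
  0 < crd p (cD d) + crd p (cD (fnx d)) ->
  exists2 k, half_square k & forall y, crd p y = wedge d k y.
Proof.
move=> s pos; have t : mtri (cD d) (cV (hd d)) (cD (fnx d)) by rewrite /= !eqxx.
have s1 := crd_sum t s; have pE := on_tri_sum ((mtriP _ _ _).2 t) s.
have p0 := crd_ge0 p.
set a := crd p (cD d) in s1 pE pos *; set b := crd p (cV (hd d)) in s1 pE *.
set c := crd p (cD (fnx d)) in s1 pE pos *.
have [a0 b0 c0] : [/\ 0 <= a, 0 <= b & 0 <= c] by split; exact: p0.
(* From [cW = 2 * r - 1 = b] and [cA = 1 - t = a]. *)
exists ((1 + b) / 2, b + c).
  by split; first split; rewrite /=; lra.
have [||o u w A B] := @coef_inner ((1 + b) / 2) (b + c); [lra|lra|].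
move=> y; rewrite pE // /wedge o u w A B.
rewrite (_ : 2 * _ - 1 = b); last by field.
rewrite (_ : 1 - (b + c) = a); last lra.
ring.
Qed.

Lemma wpt_surj f p : face_set f p -> exists i k, [/\ (i < flen f)%N,
  half_square k & p = wpt (dart f i) k].
Proof.
move=> [x fx px].
suff [d [fd [k hk pE]]] : exists d, face_of d = f /\
    exists2 k, half_square k & forall y, crd p y = wedge d k y.
  have [i im iE] := dart_surj d; rewrite fd in im iE.
  by exists i, k; split => //; rewrite iE (wpt_eq _ pE) //; case: hk.
have p0 := crd_ge0 p.
have [y [z [t s]]] := crd_support px.
(* Six cases: a dart point has five places in the triangles, a centre one. In the two cases where
   the cell is the later of two dart points, the sector is that of the preceding dart. *)
case: x fx px y z t s => [u|[d|g]] //= /eqP df px [v|[d'|g']] [w|[d''|h]] //=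
  /andP[/eqP h1 /eqP h2] s; subst.
- exists d; split => //; apply: wedge_outer_surj => //.
  exact: on_tri_rot s.
- exists d; split => //; apply: wedge_inner_surj => //.
  by rewrite ltr_wpDr.
- exists d'; split; first by rewrite face_of_fnx.
  apply: wedge_inner_surj; first exact: on_tri_rot s.
  by rewrite ltr_wpDl.
- exists d; split => //; apply: wedge_centre_surj.
  exact: on_tri_rot (on_tri_rot s).
- exists d''; split; first by rewrite face_of_fnx.
  by apply: wedge_centre_surj; exact: on_tri_rot s.
- by exists d'; split => //; exact: wedge_centre_surj.
Qed.

(** [factor_through_compact] is applied twice with the roles of [pie] and [wpt] exchanged: on the
    closed squares for [g], on [half_square] for its inverse [h]. *)
Lemma face_disc f : exists (g : plane R -> S) (h : S -> plane R),
  [/\ {within @closed_disc R, continuous g},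
      homeomorphism_on (@open_disc R) (face_set f) g h &
      forall i k, (i < flen f)%N -> square k -> g (pie (flen f) i k) = wpt (dart f i) k].
Proof.
have fl : (0 < flen f)%N by apply: leq_trans (flen_gt3 f).
have [g gE gC] := @factor_through_compact 'I_(flen f) (plane R) S (plane R)
  (wpt (val f) (0, 0)) square square (fun i => wpt (dart f i)) (fun i => pie (flen f) i)
  square_compact (@norm_hausdorff _ _) (fun i => @wpt_continuous (dart f i))
  (fun i => continuous_subspaceT (@pie_continuous R (flen f) i)) (fun _ => id)
  (fun i j s t ss st e => conj st (wpt_pie_eq (ltn_ord i) (ltn_ord j) ss st e)).
have [h hE hC] := @factor_through_compact 'I_(flen f) (plane R) (plane R) S
  (0, 0) square half_square (fun i => pie (flen f) i) (fun i => wpt (dart f i))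
  square_compact (@cplx_hausdorff R cell link)
  (fun i => continuous_subspaceT (@pie_continuous R (flen f) i))
  (fun i => @wpt_continuous (dart f i)) (fun _ h => proj1 h)
  (fun i j s t ss st e => wpt_inj (ltn_ord i) (ltn_ord j) ss st e).
have gE' i k : (i < flen f)%N -> square k -> g (pie (flen f) i k) = wpt (dart f i) k.
  by move=> im; exact: (gE (Ordinal im)).
have hE' i k : (i < flen f)%N -> half_square k -> h (wpt (dart f i) k) = pie (flen f) i k.
  by move=> im; exact: (hE (Ordinal im)).
have gC' : {within @closed_disc R, continuous g}.
  apply: continuous_subspaceW gC => q /(closed_discP fl)[i [k [im sk <- _]]].
  by exists (Ordinal im), k.
exists g, h; split => //; split.
- move=> q qd; have cd : closed_disc q by exact: ltW.
  have [i [k [im sk kq kE]]] := closed_discP fl cd.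
  have hk : half_square k.
    split=> //; have [/andP[r0 _] _] := sk.
    by rewrite -(ltr_pXn2r (ltn0Sn 1)) ?nnegrE // kE expr1n; exact: qd.
  by rewrite -kq gE' // hE' //; split=> //; exact: wpt_half.
- move=> p /wpt_surj[i [k [im hk ->]]]; have [sk k1] := hk.
  rewrite hE' // gE' //; split => //.
  rewrite /open_disc /= pie_norm; have [/andP[r0 _] _] := sk.
  by rewrite -[ltRHS](expr1n R 2) ltr_pXn2r ?nnegrE.
- by apply: continuous_subspaceW gC' => q; exact: ltW.
- apply: continuous_subspaceW hC => p /wpt_surj[i [k [im hk ->]]].
  by exists (Ordinal im), k.
Qed.

(** * Faces as connected components *)

Lemma face_set_neq0 f : face_set f !=set0.
Proof.
exists (vertex R link_size (cF f)); exists (cF f); first by rewrite /= eqxx.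
by rewrite /crd vertexE eqxx ltr01.
Qed.

Lemma face_set_eq f g : face_set f = face_set g -> f = g.
Proof.
move=> fg; have [p fp] := face_set_neq0 f.
by apply: (face_set_inj fp); rewrite -fg.
Qed.

(** The face is a union of rays of the sectors, all issuing from its centre. *)
Lemma face_set_connected f : connected (face_set f).
Proof.
have fl : (0 < flen f)%N by apply: leq_trans (flen_gt3 f).
pose P := [set ik : nat * plane R | (ik.1 < flen f)%N /\ half_square ik.2].
pose ray (ik : nat * plane R) := (fun r => wpt (dart f ik.1) (r, ik.2.2)) @` `[0, ik.2.1].
have sub k r : half_square k -> 0 <= r <= k.1 -> half_square (r, k.2).
  by move=> [[/andP[r0 _] t01] k1] /andP[h0 h1]; split=> /=; [split=> //=; lra|lra].
have -> : face_set f = \bigcup_(ik in P) ray ik.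
  rewrite eqEsubset; split => p.
    move=> /wpt_surj[i [k [im hk ->]]]; exists (i, k) => //.
    exists k.1; last by case: k hk.
    by case: hk => -[/andP[r0 _] _] _; rewrite /= in_itv /= r0 lexx.
  move=> [[i k] [/= im hk] [r]]; rewrite /= in_itv /= => rk <-.
  by apply: wpt_half; exact: sub.
apply: bigcup_connected.
  exists (wpt (val f) (0, 0)) => -[i k] [/= im hk].
  have [[/andP[r0 r1] t01] _] := hk.
  exists 0; first by rewrite /= in_itv /= lexx r0.
  by rewrite /wpt (@wedge_centre _ (val f) _ 0) ?face_of_dart ?face_of_val // lexx ler01.
move=> [i k] [/= im hk]; apply: connected_continuous_connected.
  exact: segment_connected.
have [[/andP[r0 r1] t01] _] := hk.
apply: (@to_set_type_within {ptws cell -> R} C R `[0, k.1]%classic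
  (fun r => wpt (dart f i) (r, k.2)) (fun r => wedge (dart f i) (r, k.2))).
  move=> r; rewrite /= in_itv /= => rk.
  by have [/(wedge_cplx (dart f i)) h _] := sub k r hk rk; rewrite /wpt to_cplxE.
apply: continuous_subspaceT => r.
apply: (@continuous_comp R (plane R) {ptws cell -> R} (fun r : R => (r, k.2))
  (wedge (dart f i))); last exact: wedge_continuous.
have c1 : {for r, continuous (fun r : R => r)} by exact: cvg_id.
have c2 : {for r, continuous (fun _ : R => k.2)} by exact: cst_continuous.
exact: (cvg_pair c1 c2).
Qed.

(** In the complement of the graph the set is open, and also closed because the other faces form an
    open set; a connected set that meets it stays inside. *)
Lemma face_component f p : connected (face_set f) -> face_set f p ->
  connected_component (~` (emb @` realization e)) p = face_set f.
Proof.
move=> cf fp; rewrite eqEsubset; split; last first.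
  apply: connected_component_max => // q fq; apply/compl_emb; by exists f.
move=> q [K [Kp Ksub cK] Kq].
have KE : K `&` face_set f = K.
  apply: cK.
  - by exists p.
  - by exists (face_set f) => //; exact: face_set_open.
  - exists (~` \bigcup_(g in [set g | g != f]) face_set g).
      apply: open_closedC; apply: bigcup_open => g _; exact: face_set_open.
    rewrite eqEsubset; split=> x [Kx fx]; split => //.
      move=> [g /= gf gx]; move: gf; rewrite (face_set_inj gx fx) eqxx //.
    have /compl_emb[g gx] := Ksub _ Kx.
    have [<-//|gf] := eqVneq g f.
    by case: fx; exists g.
by move: Kq; rewrite -KE => -[].
Qed.

(** * Colours and boundary circuits *)

Definition colF (f : face_type) := col (val f).
Lemma col_dart f i : col (dart f i) = colF f.
Proof. by elim: i => //= i <-; rewrite col_fnx. Qed.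
Lemma col_face d : colF (face_of d) = col d.
Proof. by have [i _ <-] := dart_surj d; rewrite col_dart face_of_dart. Qed.

Definition circ (f : face_type) : seq V := [seq tl d | d <- orbit fnx (val f)].

Lemma size_circ f : size (circ f) = flen f.
Proof. by rewrite size_map size_orbit. Qed.

Lemma rot_circ f : rot 1 (circ f) = [seq hd d | d <- orbit fnx (val f)].
Proof.
rewrite /circ -map_rot (rot1_fcycle (cycle_orbit fnx_inj _)) -map_comp.
by apply: eq_map => d /=; exact: tl_fnx.
Qed.

Lemma nth_orbit_map (T : Type) (F : D -> T) x0 f i : (i < flen f)%N ->
  nth x0 [seq F d | d <- orbit fnx (val f)] i = F (dart f i).
Proof.
by move=> im; rewrite (nth_map (val f)) ?size_orbit // /orbit nth_traject.
Qed.

Definition edge_of d : {set V} := [set tl d; hd d]%SET.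

Lemma step_edges_circ f : step_edges (circ f) = [seq edge_of d | d <- orbit fnx (val f)].
Proof. by rewrite /step_edges /steps rot_circ zip_map -map_comp. Qed.

(** The two darts of an edge have opposite colours. Hence no face repeats an edge, the faces of one
    colour share none, and the faces on the two sides of an edge differ in colour. *)
Lemma edge_of_inj d d' : edge_of d = edge_of d' -> col d = col d' -> d = d'.
Proof.
move=> /(set2_eq (tl_neq_hd d)) [[h1 h2] _|[h1 h2]]; first exact: dart_inj.
have -> : d = rev d' by apply: dart_inj; rewrite // hd_rev.
by rewrite col_rev; case: (col _).
Qed.

Lemma circ_circuit f : circuit e (circ f).
Proof.
apply/and3P; split.
- by rewrite -size_eq0 size_circ; have := flen_gt3 f; case: (flen f).
- rewrite /steps rot_circ zip_map all_map; apply/allP => d _ /=.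
  exact: edge_dart.
- rewrite step_edges_circ map_inj_in_uniq ?orbit_uniq // => d d'.
  rewrite !mem_orbit_face => /eqP df /eqP df' h; apply: edge_of_inj h _.
  by rewrite -!col_face df df'.
Qed.

Definition circs b := [seq circ f | f <- enum {: face_type} & colF f == b].

Lemma circsP b c : reflect (exists2 f, colF f = b & c = circ f) (c \in circs b).
Proof.
apply: (iffP mapP) => [[f]|[f fb ->]].
  by rewrite mem_filter => /andP[/eqP fb _] ->; exists f.
by exists f; rewrite // mem_filter fb eqxx mem_enum.
Qed.

Lemma circs_decomposition b : circuit_decomposition e (circs b).
Proof.
apply/andP; split.
  by apply/allP => c /circsP[f _ ->]; exact: circ_circuit.
rewrite /circs -map_comp; apply: uniq_perm.
- apply: uniq_flatten; first by rewrite filter_uniq ?enum_uniq.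
    by move=> f _ /=; case/and3P: (circ_circuit f).
  move=> f g; rewrite !mem_filter => /andP[/eqP fb _] /andP[/eqP gb _] A /=.
  rewrite !step_edges_circ => /mapP[d]; rewrite mem_orbit_face => /eqP df ->.
  move=> /mapP[d']; rewrite mem_orbit_face => /eqP df' h.
  rewrite -df -df'; congr face_of; apply: edge_of_inj h _.
  by rewrite -!col_face df df' fb gb.
- exact: enum_uniq.
move=> A; rewrite mem_enum finset.in_set; apply/flatten_mapP/existsP.
  move=> [f _ /=]; rewrite step_edges_circ => /mapP[d _ ->].
  by exists (tl d); apply/existsP; exists (hd d); rewrite edge_dart eqxx.
move=> [u /existsP[v /andP[uv /eqP ->]]].
have [d [db dA]] : exists d, col d = b /\ [set u; v]%SET = edge_of d.
  have [d <- <-] := dart_edge uv; have [db|db] := eqVneq (col d) b; first by exists d.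
  exists (rev d); split; first by rewrite col_rev; move: db; case: (col d); case: b.
  by rewrite /edge_of hd_rev finset.setUC.
exists (face_of d); first by rewrite mem_filter col_face db eqxx mem_enum.
by rewrite /= step_edges_circ dA map_f // mem_orbit_face.
Qed.

Lemma circ_bounds f : bounded_by emb (face_set f) (circ f).
Proof.
have [g [h [gC gh gE]]] := face_disc f.
exists g, h; split => // x0 i t; rewrite size_circ => im.
rewrite in_unit => /andP[t0 t1] a.
rewrite rot_circ !nth_orbit_map //.
(* At [r = 1] only [cU = 1 - t] and [cW = t] remain: the arc follows the edge with the parameter
   that [bounded_by] prescribes. *)
have sq : square (1, t) by split=> /=; lra.
have -> : (cos a, sin a) = pie (flen f) i (1, t) by rewrite /pie /= !mul1r.
rewrite gE //; apply: wpt_eq => // x.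
have rr : realization e (edge_point (tl (dart f i)) (hd (dart f i)) t).
  by exists (tl (dart f i)), (hd (dart f i)), t; rewrite edge_dart orbT in_unit t0 t1.
rewrite crd_emb //.
have [||o u w A B] := @coef_outer 1 t; [lra|lra|].
rewrite /wedge o u w A B; case: x => [v|[d|g']] /=; rewrite /edge_point.
- rewrite -![cV v == _]/(v == _); ring.
- ring.
- ring.
Qed.

(** The intersection of the stars of [u] and [v] is a neighbourhood of the midpoint of the edge, so
    it meets the face. Only the two triangles on the edge contain both ends, and their third corner
    is the required dart. *)
Lemma incident_face f u v : e u v -> incident emb (face_set f) u v ->
  exists2 d, face_of d = f & (tl d = u /\ hd d = v) \/ (tl d = v /\ hd d = u).
Proof.
move=> uv inc.
have uNv : u != v by apply: contraTneq uv => ->; rewrite e_irr.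
have t01 : (1 / 2 : R) \in `[0, 1]%classic by rewrite in_unit; lra.
have rr : realization e (edge_point u v (1 / 2 : R)).
  by exists u, v, (1 / 2); split => //; rewrite uv orbT.
have hst x : x \in [:: u; v] -> star (cV x) (emb (edge_point u v (1 / 2))).
  move=> xuv; suff : 0 < crd (emb (edge_point u v (1 / 2))) (cV x) by [].
  rewrite crd_emb //= /edge_point; move: xuv.
  by rewrite !inE => /orP[] /eqP ->; rewrite eqxx ?(negbTE uNv) 1?eq_sym ?(negbTE uNv) /=; lra.
have [|q [[x fx qx] [qu qv]]] := inc _ t01 (star (cV u) `&` star (cV v)).
  apply: open_nbhs_nbhs; split; first by apply: openI; exact: star_open.
  by split; apply: hst; rewrite !inE eqxx ?orbT.
have [y [z [t s]]] := crd_support qu.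
have mem w : 0 < crd q w -> w \in [:: cV u; y; z].
  by move=> qw; apply: contraTT qw => /s ->; rewrite ltxx.
have := mem _ qx; have := mem _ qv.
case: y z t {s mem} => [v'|[d|g]] [w|[d'|h]] //= /andP[/eqP h1 /eqP h2];
  rewrite !inE => hv hx;
  case/or3P: hv => /eqP // -[vv]; try by rewrite vv eqxx in uNv.
- exists d'.
    by move: hx fx; rewrite /= => /or3P[] /eqP -> //= /eqP.
  by left; split => //; rewrite h2.
- exists d.
    by move: hx fx; rewrite /= => /or3P[] /eqP -> //= /eqP.
  by right; split => //; rewrite h1.
Qed.

Lemma faceP F : face e emb F <-> exists f, F = face_set f.
Proof.
split=> [[p /compl_emb[f fp] ->]|[f ->]].
  by exists f; apply: face_component => //; exact: face_set_connected.
have [p fp] := face_set_neq0 f; exists p; first by apply/compl_emb; exists f.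
by rewrite (face_component (@face_set_connected f) fp).
Qed.

Lemma emb_cellular : cellular e emb.
Proof.
move=> F /faceP[f ->]; have [g [h [_ [h1 h2 h3 h4] _]]] := face_disc f.
by exists h, g.
Qed.

Lemma emb_biembedding : biembedding e emb.
Proof.
exists (circs true), (circs false); split.
- exact: emb_embedding.
- exact: circs_decomposition.
- exact: circs_decomposition.
pose color (F : set S) := `[< exists2 f, F = face_set f & colF f >].
have colorE f : color (face_set f) = colF f.
  apply/asboolP/idP => [[g /face_set_eq <-]//|fc]; by exists f.
exists color; split.
- move=> _ _ u v /faceP[f ->] /faceP[g ->] FG uv fi gi; rewrite !colorE.
  have [d df du] := incident_face uv fi; have [d' dg du'] := incident_face uv gi.
  rewrite -df -dg !col_face => cc; apply: FG; congr face_set.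
  rewrite -df -dg; congr face_of; apply: edge_of_inj cc.
  by rewrite /edge_of; case: du => -[-> ->]; case: du' => -[-> ->] //;
    rewrite finset.setUC.
- split=> [_ /faceP[f ->]|_ /circsP[f fb ->]].
    by rewrite colorE => fb; exists (circ f); [apply/circsP; exists f|exact: circ_bounds].
  exists (face_set f); split; [|by rewrite colorE|exact: circ_bounds].
  by apply/faceP; exists f.
- split=> [_ /faceP[f ->]|_ /circsP[f fb ->]].
    by rewrite colorE => fb; exists (circ f); [apply/circsP; exists f|exact: circ_bounds].
  exists (face_set f); split; [|by rewrite colorE|exact: circ_bounds].
  by apply/faceP; exists f.
Qed.

Theorem map_biembedding : exists (T : topologicalType) (phi : {ptws V -> R} -> T),
  [/\ surface R T, orientable R T, biembedding e phi, cellular e phi &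
    forall F : set T, face e phi F -> exists d, face_length e phi F (order fnx d)].
Proof.
exists S, emb; split.
- exact: cplx_surface link_uniq link_size link_rot link_connected.
- exact: cplx_orientable link_uniq link_size link_rot.
- exact: emb_biembedding.
- exact: emb_cellular.
move=> F /faceP[f ->]; exists (val f), (circ f); split.
- exact: circ_circuit.
- exact: circ_bounds.
- exact: size_circ.
Qed.
End Map.

(** * The biembedding of the complete multipartite graph *)

Section Multipartite.
Local Open Scope nat_scope.
Variable n : nat.
Hypothesis n_gt2 : (2 < n)%N.

Local Notation node := ('I_n.+1 * 'I_(2 * n))%type.
Local Notation arrow := (node * 'I_(n ^ 2) * bool)%type.

(** * Nodes as residues modulo [order_Z] *)

Definition order_Z := (2 * n * n.+1)%N.
(* [step] enumerates, for [i < n ^ 2], the integers below [n * n.+1] that are not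
   multiples of [n.+1]. *)
Definition step (i : nat) := (i %/ n * n.+1 + (i %% n).+1)%N.
(** The first component, which is the part of the node, becomes the residue modulo [n.+1]; adjacency
    is thereby a condition on differences. *)
Definition code (g : node) := (g.2 * n.+1 + g.1)%N.

Lemma n_gt0 : (0 < n)%N. Proof. by lia. Qed.
Lemma order_Z_gt0 : (0 < order_Z)%N. Proof. by have := n_gt0; rewrite /order_Z; nia. Qed.

Lemma order_ZE : order_Z = n * n.+1 + n * n.+1.
Proof. by rewrite /order_Z -mulnA mul2n addnn. Qed.

Lemma code_lt g : (code g < order_Z)%N.
Proof. by case: g => [[a ha] [b hb]]; rewrite /code /order_Z /=; nia. Qed.

Lemma code_mod g : (code g %% n.+1)%N = g.1.
Proof. by rewrite /code modnMDl modn_small. Qed.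

Lemma code_div g : (code g %/ n.+1)%N = g.2.
Proof. by rewrite /code divnMDl // divn_small // addn0. Qed.

Lemma code_inj : injective code.
Proof.
move=> g h e; apply/eqP; rewrite -pair_eqE /pair_eq -!val_eqE /=.
by rewrite -!code_mod -!code_div e !eqxx.
Qed.

Lemma decode_subproof x : ((x %% order_Z) %/ n.+1 < 2 * n)%N.
Proof. by rewrite ltn_divLR // ltn_pmod // order_Z_gt0. Qed.

Definition decode (x : nat) : node :=
  (inord (x %% order_Z %% n.+1), Ordinal (decode_subproof x)).

Lemma decodeK x : code (decode x) = (x %% order_Z)%N.
Proof.
rewrite /code /decode /= inordK ?ltn_pmod //.
by rewrite -divn_eq.
Qed.


(** Subtracting [step i] is encoded as adding its complement to [order_Z], which stays within
    natural numbers. *)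
Definition offset (i : nat) (b : bool) := if b then step i else (order_Z - step i)%N.
Definition translate (i : nat) (b : bool) (g : node) : node := decode (code g + offset i b).

Lemma step_bounds i : (i < n ^ 2)%N -> (0 < step i < n * n.+1)%N.
Proof.
move=> h; have h1 : (i %/ n < n)%N by rewrite ltn_divLR ?n_gt0 // -expnSr; exact: h.
have h2 : (i %% n < n)%N by rewrite ltn_pmod // n_gt0.
by rewrite /step; nia.
Qed.

Lemma step_mod i : (step i %% n.+1)%N = (i %% n).+1.
Proof.
rewrite /step modnMDl modn_small //.
by have : (i %% n < n)%N by [rewrite ltn_pmod // n_gt0]; lia.
Qed.

Lemma step_div i : (step i %/ n.+1)%N = (i %/ n)%N.
Proof.
rewrite /step divnMDl // (@divn_small (i %% n).+1) ?addn0 //.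
by have : (i %% n < n)%N by [rewrite ltn_pmod // n_gt0]; lia.
Qed.

Lemma step_inj i j : step i = step j -> i = j.
Proof.
move=> e; rewrite (divn_eq i n) (divn_eq j n) -!step_div e.
by congr (_ + _)%N; apply: succn_inj; rewrite -!step_mod e.
Qed.

Lemma step_surj x : (0 < x < n * n.+1)%N -> ~~ (n.+1 %| x)%N ->
  exists2 i, (i < n ^ 2)%N & step i = x.
Proof.
move=> /andP[x0 xn] nx.
have m0 : (0 < x %% n.+1)%N by rewrite lt0n.
have m1 : (x %% n.+1 < n.+1)%N by rewrite ltn_pmod.
have d1 : (x %/ n.+1 < n)%N by rewrite ltn_divLR.
have n0 := n_gt0.
exists (x %/ n.+1 * n + (x %% n.+1).-1)%N; first by nia.
have mn : (x %% n.+1).-1 < n by lia.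
rewrite /step divnMDl // modnMDl (divn_small mn) (modn_small mn) addn0.
by rewrite [RHS](divn_eq x n.+1); lia.
Qed.

Lemma offset_bounds (i : 'I_(n ^ 2)) b : (0 < offset i b < order_Z)%N.
Proof.
by have := step_bounds (ltn_ord i); rewrite /offset order_ZE; case: b; lia.
Qed.

Lemma offset_negb (i : 'I_(n ^ 2)) b : (offset i b + offset i (~~ b))%N = order_Z.
Proof.
by have := step_bounds (ltn_ord i); rewrite /offset order_ZE; case: b => /=; lia.
Qed.

Lemma offset_ndvd (i : 'I_(n ^ 2)) b : ~~ (n.+1 %| offset i b)%N.
Proof.
have d : (n.+1 %| order_Z)%N by rewrite dvdn_mull.
have s : ~~ (n.+1 %| step i)%N by rewrite /dvdn step_mod.
case: b => //; apply: contra s => h.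
by rewrite -(dvdn_addl _ h) (offset_negb i true).
Qed.

Lemma code_translate i b g : code (translate i b g) = ((code g + offset i b) %% order_Z)%N.
Proof. exact: decodeK. Qed.

Lemma translateK (i : 'I_(n ^ 2)) b : cancel (translate i b) (translate i (~~ b)).
Proof.
move=> g; apply: code_inj; rewrite !code_translate modnDml -addnA offset_negb.
by rewrite modnDr modn_small // code_lt.
Qed.

Lemma translate_edge (i : 'I_(n ^ 2)) b g : multipartite g (translate i b g).
Proof.
have d : (n.+1 %| order_Z)%N by rewrite dvdn_mull.
apply/eqP => /(congr1 (@nat_of_ord _)).
rewrite -!code_mod code_translate modn_dvdm // => e.
have : offset i b == 0 %[mod n.+1] by rewrite -(eqn_modDl (code g)) addn0 e.
by rewrite mod0n; apply/negP; exact: offset_ndvd.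
Qed.

Lemma edge_translate u w : multipartite u w -> exists (i : 'I_(n ^ 2)) b, translate i b u = w.
Proof.
rewrite /multipartite -val_eqE /= -!code_mod => uw.
have d : (n.+1 %| order_Z)%N by rewrite dvdn_mull.
pose x := ((code w + (order_Z - code u)) %% order_Z)%N.
have hu := code_lt u; have hw := code_lt w.
have xE : ((code u + x) %% order_Z)%N = code w.
  rewrite /x modnDmr addnCA subnKC; last exact: ltnW.
  by rewrite modnDr modn_small.
have xlt : (x < order_Z)%N by rewrite ltn_pmod // order_Z_gt0.
have nx : ~~ (n.+1 %| x)%N.
  apply: contra uw => h; rewrite -xE modn_dvdm //.
  by rewrite -modnDmr (eqP h) addn0.
have x0 : (0 < x)%N by case: x nx {xE xlt} => //; rewrite dvdn0.
case: (ltnP x (n * n.+1)) => h.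
  have [i im ix] := step_surj (introT andP (conj x0 h)) nx.
  exists (Ordinal im), true; apply: code_inj.
  by rewrite code_translate /offset /= ix.
have nx' : ~~ (n.+1 %| order_Z - x)%N by rewrite dvdn_subr // ltnW.
have h' : (0 < order_Z - x < n * n.+1)%N.
  have xn : x != (n * n.+1)%N by apply: contraNneq nx => ->; rewrite dvdn_mull.
  move: h xn xlt; rewrite order_ZE; move: (n * n.+1) (x) => M y h h' h''.
  by clear -h h' h''; lia.
have [i im ix] := step_surj h' nx'.
exists (Ordinal im), false; apply: code_inj.
by rewrite code_translate /offset /= ix subKn // ltnW.
Qed.

Lemma translate_inj_dart (i j : 'I_(n ^ 2)) b c g :
  translate i b g = translate j c g -> i = j /\ b = c.
Proof.
move=> /(congr1 code); rewrite !code_translate => /eqP.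
rewrite eqn_modDl => /eqP.
have /andP[_ h1] := offset_bounds i b; have /andP[_ h2] := offset_bounds j c.
rewrite !modn_small // => e.
have s1 := step_bounds (ltn_ord i); have s2 := step_bounds (ltn_ord j).
(* Forward offsets lie below [n * n.+1], half of [order_Z], and backward ones above it. *)
have bc : b = c by move: e; rewrite /offset order_ZE; case: b {h1}; case: c {h2} => //; lia.
split => //; apply: ord_inj; apply: step_inj; subst c.
by move: e; rewrite /offset order_ZE; case: b {h1 h2} => //; lia.
Qed.

(** * Darts, faces and rotation *)

Definition dtl (d : arrow) : node := d.1.1.
Definition drev (d : arrow) : arrow := (translate d.1.2 d.2 d.1.1, d.1.2, ~~ d.2).
(** The dart [(g, i, b)] leaves [g] along the [i]-th difference, with sign [b]. A face keeps the
    sign, which serves as its colour, and advances the index modulo [n ^ 2]. *)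
Definition dnext (d : arrow) : arrow := (translate d.1.2 d.2 d.1.1, ordS d.1.2, d.2).

Lemma drevK : involutive drev.
Proof. by case=> -[g i] b; rewrite /drev /= translateK negbK. Qed.

Lemma dnext_inj : injective dnext.
Proof.
move=> [[g i] b] [[h j] c] E.
have bc : b = c by exact: (congr1 snd E).
have ij : i = j by apply: (can_inj (@ordSK _)); exact: (congr1 (fun d => d.1.2) E).
subst c j; congr (_, _, _); apply: (can_inj (translateK i b)).
exact: (congr1 (fun d => d.1.1) E).
Qed.

Lemma iter_dnext k d : (iter k dnext d).1.2 = (d.1.2 + k) %% n ^ 2 :> nat.
Proof.
elim: k => [|k IH] /=; first by rewrite addn0 modn_small.
by rewrite IH -addn1 modnDml addn1 addnS.
Qed.

Lemma dvdn_order_dnext d : (n ^ 2 %| order dnext d)%N.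
Proof.
have := iter_dnext (order dnext d) d; rewrite iter_order; last exact: dnext_inj.
move=> h; have : order dnext d == 0 %[mod n ^ 2].
  by rewrite -(eqn_modDl d.1.2) addn0 -h modn_small.
by rewrite mod0n.
Qed.

(** [dnext \o drev] is the inverse of the vertex rotation: it fixes the tail, advances the index and
    flips the sign, which is easier to iterate than [finv]. *)
Lemma iter_rotation k (g : node) i b :
  iter k (fun d => dnext (drev d)) (g, i, b) =
  (g, iter k (@ordS _) i, odd k (+) b).
Proof.
elim: k => //= k ->; rewrite /dnext /drev /= translateK.
by case: (odd k); case: b.
Qed.

Lemma val_iter_ordS N k (i : 'I_N) : iter k (@ordS N) i = (i + k) %% N :> nat.
Proof.
elim: k => [|k IH] /=; first by rewrite addn0 modn_small.
by rewrite IH -addn1 modnDml addn1 addnS.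
Qed.

Lemma rotation_transitive (n_odd : odd n) d d' : dtl d = dtl d' ->
  fconnect (fun d => drev (finv dnext d)) d d'.
Proof.
case: d => [[g i] b]; case: d' => [[h j] c]; rewrite /dtl /= => <- {h}.
set tau := fun d => _.
have tauK d : tau (dnext (drev d)) = d.
  by rewrite /tau finv_f ?drevK //; exact: dnext_inj.
have tau_inj : injective tau.
  move=> d d' /(can_inj drevK); apply: (can_inj (f_finv dnext_inj)).
have iterK k d : iter k tau (iter k (fun d => dnext (drev d)) d) = d.
  by elim: k d => // k IH d; rewrite iterSr /= tauK IH.
have im := ltn_ord i; have jm := ltn_ord j.
have oN : odd (n ^ 2) by rewrite oddX n_odd.
(* Index modulo [n ^ 2] and sign modulo 2 are prescribed independently: [k0] reaches the index, and
   one more turn of odd length [n ^ 2] corrects the sign if necessary. The summand [n ^ 2] in [k0]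
   keeps the subtraction exact. *)
have [k [kij kb]] : exists k, iter k (@ordS _) i = j /\ odd k (+) b = c.
  pose k0 := (j + n ^ 2 - i)%N.
  have k0E m : iter (k0 + m * n ^ 2) (@ordS _) i = j.
    apply: ord_inj; rewrite val_iter_ordS /k0.
    rewrite (_ : (i + (j + n ^ 2 - i + m * n ^ 2) = j + m.+1 * n ^ 2)%N); last first.
      by rewrite mulSn; lia.
    by rewrite addnC modnMDl modn_small.
  have [h|h] := eqVneq (odd k0 (+) b) c.
    by exists (k0 + 0 * n ^ 2)%N; split=> //; rewrite mul0n addn0.
  exists (k0 + 1 * n ^ 2)%N; split=> //; rewrite mul1n oddD oN.
  by move: h; case: (odd k0); case: b; case: c.
have := iter_rotation k g i b; rewrite kij kb => kE.
rewrite fconnect_sym //; rewrite -(iterK k (g, i, b)) kE.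
exact: fconnect_iter.
Qed.

Lemma multipartite_connected (u w : node) : connect (@multipartite n.+1 (2 * n)) u w.
Proof.
have [uw|uw] := boolP (multipartite u w); first exact: connect1.
have [a au] : exists a : 'I_n.+1, a != u.1.
  have [->|h] := eqVneq u.1 ord0; first by exists ord_max; rewrite -val_eqE /=; lia.
  by exists ord0; rewrite eq_sym.
have uwE : u.1 = w.1 by apply/eqP; rewrite -[_ == _]negbK.
apply: (@connect_trans _ _ (a, u.2)); apply: connect1.
  by rewrite /multipartite /= eq_sym.
by rewrite /multipartite /= -uwE.
Qed.

Lemma dart_of_edge (u w : node) : multipartite u w ->
  exists2 d, dtl d = u & hd dtl drev d = w.
Proof. by move=> /edge_translate[i [b uw]]; exists (u, i, b). Qed.

Lemma multipartite_irr : irreflexive (@multipartite n.+1 (2 * n)).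
Proof. by move=> u; rewrite /multipartite eqxx. Qed.

Lemma dart_ends_inj d d' :
  dtl d = dtl d' -> hd dtl drev d = hd dtl drev d' -> d = d'.
Proof.
case: d => [[g i] b]; case: d' => [[h j] c]; rewrite /hd /dtl /= => <-.
by move=> /translate_inj_dart[-> ->].
Qed.

Lemma face_gt3 d : 3 < order dnext d.
Proof.
have := dvdn_leq (order_gt0 dnext d) (dvdn_order_dnext d).
by apply: leq_trans; apply: (@leq_trans (3 ^ 2)) => //; rewrite leq_sqr.
Qed.

Lemma dart_at (u : node) : exists d, dtl d == u.
Proof.
have N0 : 0 < n ^ 2 by rewrite expn_gt0 n_gt0.
by exists (u, Ordinal N0, true); rewrite /dtl /=.
Qed.
End Multipartite.

Theorem proposition5p8 (R : realType) (n : nat)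
    (n_prime : prime n) (n_odd : odd n) :
  exists (S : topologicalType) (phi : {ptws ('I_n.+1 * 'I_(2 * n)) -> R} -> S),
    [/\ surface R S,
        orientable R S,
        biembedding (@multipartite n.+1 (2 * n)) phi,
        cellular (@multipartite n.+1 (2 * n)) phi &
        forall F : set S, face (@multipartite n.+1 (2 * n)) phi F ->
          exists2 k : nat, face_length (@multipartite n.+1 (2 * n)) phi F k &
            k = (4 * n)%N \/ (n ^ 2 %| k)%N].
Proof.
have n_gt2 : (2 < n)%N by rewrite odd_prime_gt2.
have n_gt0 : (0 < n)%N by lia.
have N0 : (0 < n ^ 2)%N by rewrite expn_gt0 n_gt0.
(* The colour of a dart is its sign [snd], and [v0] is the node of code 0. The three hypotheses
   [tl_fnx], [col_fnx] and [col_rev] hold by computation. *)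
have [S [phi [h1 h2 h3 h4 h5]]] := @map_biembedding
  ('I_n.+1 * 'I_(2 * n))%type ('I_n.+1 * 'I_(2 * n) * 'I_(n ^ 2) * bool)%type
  (@multipartite n.+1 (2 * n)) (@dtl n) (@drev n n_gt2) (@dnext n n_gt2) snd
  (@drevK n n_gt2) (@dnext_inj n n_gt2) (fun=> erefl) (fun=> erefl) (fun=> erefl)
  (@dart_of_edge n n_gt2) (fun d => @translate_edge n n_gt2 _ _ _)
  (@multipartite_irr n) (@dart_ends_inj n n_gt2) (@face_gt3 n n_gt2)
  (@dart_at n n_gt2) (@rotation_transitive n n_gt2 n_odd)
  (@multipartite_connected n n_gt2) R (decode n_gt2 0).
exists S, phi; split => // F /h5[d dF].
by exists (order (dnext n_gt2) d); [|right; exact: dvdn_order_dnext].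
Qed.
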